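(* Let $G$ be a finite graph in which three edges $e_1,e_2,e_3\in E(G)$ form a triangle. Let $A=G-e_1$, $B=G-e_2$, and $A\cap B=G-e_1-e_2$. Then there is a long exact sequence $$\cdots\to H_i(A\cap B)\xrightarrow{\ \varphi\ }H_i(A)\oplus H_i(B)\xrightarrow{\ \psi\ }H_i(G)\xrightarrow{\ \delta\ }H_{i-1}(A\cap B)\to\cdots\to H_0(G)\to 0$$ of chromatic symmetric homology modules, where $\varphi$ and $\psi$ are induced by the chain-level maps $x\mapsto(x,-x)$ and $(a,b)\mapsto a+b$.
   Context: Graphs are finite; loops and multiple edges are allowed. $V=V(G)=\{v_1,\dots,v_n\}$, $E=E(G)$, with a fixed enumeration of the $m$ edges; $G-e$ denotes deletion of the edge $e$ (same vertex set, inherited edge order). Three edges form a triangle if they join pairwise three distinct vertices. $\mathfrak S_V\cong\mathfrak S_n$ is the symmetric group on $V$; representations are over $\mathbb C$; $\mathcal S^\lambda$ is the Specht module indexed by $\lambda\vdash n$. States and modules. A state of $G$ is a spanning subgraph, identified with its edge set $F\subseteq E$. For $a\ge1$ let $\mathcal L_a=\bigoplus_{i=0}^{a-1}\mathcal S^{(a-i,1^i)}$, graded with $\mathcal S^{(a-i,1^i)}$ in degree $i$; equivalently $\mathcal L_a\cong\bigwedge^*\mathcal S^{(a-1,1)}$ with the exterior grading (for $a=1$ put $\mathcal S^{(0,1)}=0$). If the connected components of $(V,F)$ have vertex sets $B_1,\dots,B_r$ of sizes $b_1,\dots,b_r$, let $\mathfrak S_F=\mathfrak S_{B_1}\times\cdots\times\mathfrak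 S_{B_r}$ and $\mathcal M_F=\mathrm{Ind}_{\mathfrak S_F}^{\mathfrak S_V}(\mathcal L_{b_1}\otimes\cdots\otimes\mathcal L_{b_r})$, a graded $\mathfrak S_V$-module. Concretely: realise $\mathcal S^{(b-1,1)}$ for a $b$-element set $B$ as $W_B=\{x\in\mathbb C^B:\sum_{v\in B}x_v=0\}$, put $W_F=\bigoplus_kW_{B_k}\subseteq\mathbb C^V$; then $\mathcal L_{b_1}\otimes\cdots\otimes\mathcal L_{b_r}=\bigwedge^*W_F$ and $\mathcal M_F=\mathbb C[\mathfrak S_V]\otimes_{\mathbb C[\mathfrak S_F]}\bigwedge^*W_F$. Chain modules: $C_{i,j}(G)=\bigoplus_{|F|=i}(\mathcal M_F)_j$, $C_i(G)=\bigoplus_jC_{i,j}(G)$. For a spanning subgraph $A$ of $G$, states of $A$ are states of $G$, so $C_i(A)\subseteq C_i(G)$. Per-edge maps: let $F'=F-e$ with $e\in F$; write $\varepsilon$ for the corresponding edge of the Boolean lattice of states. If $F$ and $F'$ have the same components, $d_\varepsilon:\mathcal M_F\to\mathcal M_{F'}$ is the identity. Otherwise a component of $F$ splits into two components $P,Q$ of $F'$. In the case that $F$ has only one component, $\mathrm{Res}_{\mathfrak S_P\times\mathfrak S_Q}W_V=\mathcal T\oplus\mathbf 1$ with $\mathcal T=W_P\oplus W_Q$ and $\mathbf 1$ trivial, so $\mathrm{Res}\,\bigwedge^*W_V=\bigwedge^*\mathcal T\oplus(\bigwedge^*\mathcal T)[1]$, where $(\bigwedge^*\mathcal T)[1]=\bigwedge^*\mathcal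 T\wedge\mathbf 1$, and $d_\varepsilon$ is the map corresponding under Frobenius reciprocity to the $(\mathfrak S_P\times\mathfrak S_Q)$-map that is the identity on $\bigwedge^*\mathcal T$ and zero on $(\bigwedge^*\mathcal T)[1]$. In general $d_\varepsilon$ is obtained by tensoring this map with the identity on the factors of the other components and inducing to $\mathfrak S_V$. Explicitly, $d_\varepsilon(g\otimes x)=\sum_{h\in\mathfrak S_F/\mathfrak S_{F'}}gh\otimes(\bigwedge^*\pi)(h^{-1}x)$, where $\pi:W_F\to W_{F'}$ is the orthogonal projection. Signs and differential: encode $F$ by the binary string $z_1\cdots z_m$ with $z_i=1$ if the $i$th edge is in $F$ and $z_i=0$ otherwise. If $e$ is the $k$th edge, $\mathrm{sgn}(\varepsilon)=(-1)^{s}$, where $s$ is the number of ones in positions after the $k$th. Set $d_i=\sum_\varepsilon\mathrm{sgn}(\varepsilon)d_\varepsilon:C_i(G)\to C_{i-1}(G)$, the sum over all $\varepsilon$ from a state with $i$ edges to one with $i-1$ edges, and $d_{i,j}:C_{i,j}(G)\to C_{i-1,j}(G)$ its degree $j$ part. Homology: $H_{i,j}(G)=\ker d_{i,j}/\mathrm{im}\,d_{i+1,j}$ and $H_i(G)=\bigoplus_{j\ge0}H_{i,j}(G)$. *)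

(* Defs.v *)
From HB Require Import structures.
From mathcomp Require Import all_boot all_order all_fingroup all_algebra all_field.
From mathcomp Require Import reals complex.

Set Implicit Arguments.
Unset Strict Implicit.
Unset Printing Implicit Defensive.

Import Order.TTheory GRing.Theory Num.Theory.
Local Open Scope ring_scope.

Section QuotientSpace.
Variables (K : fieldType) (U : vectType K) (W : {vspace U}).

(* U / W: each class is represented by its unique element in a fixed
   complement of W; qpi is the canonical surjection and its kernel is W. *)
Definition quotv : vectType K := subvs_of (W^C)%VS.

Definition qpi : 'Hom(U, quotv) :=
  linfun (vsproj (W^C)%VS \o daddv_pi (W^C)%VS W).

Definition qrepr : 'Hom(quotv, U) := linfun (@vsval K U (W^C)%VS).

Lemma qreprK y : qpi (qrepr y) = y.
Proof.
rewrite !lfunE /= daddv_pi_id ?subvsP ?vsvalK //.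
by rewrite capvC capv_compl.
Qed.

Lemma lker_qpi : lker qpi = W.
Proof.
have dW : (W^C :&: W = 0)%VS by rewrite capvC capv_compl.
have WW : (W :&: W^C = 0)%VS by rewrite capv_compl.
apply/vspaceP => u; rewrite memv_ker lfunE /=.
have u_in : u \in (W^C + W)%VS by rewrite addvC addv_complf memvf.
have uE := daddv_pi_add dW u_in.
apply/eqP/idP => [u0 | Wu].
  have : vsval (vsproj (W^C)%VS (daddv_pi (W^C)%VS W u)) = 0 by rewrite u0.
  rewrite vsprojK ?memv_pi // => u0'.
  by rewrite -uE u0' add0r memv_pi.
have -> : daddv_pi (W^C)%VS W u = 0.
  by apply: (addIr (daddv_pi W (W^C)%VS u)); rewrite uE add0r daddv_pi_id.
exact: linear0.
Qed.

End QuotientSpace.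

Section DirectSum.
Import VectorInternalTheory.
Variables (K : fieldType) (I : finType) (T : I -> vectType K).

Definition dsum := {dffun forall i, T i}.
HB.instance Definition _ := Choice.on dsum.
Implicit Types f g : dsum.

Definition dsum0 : dsum := [ffun i => 0 : T i].
Definition dsum_opp f : dsum := [ffun i => - f i].
Definition dsum_add f g : dsum := [ffun i => f i + g i].
Definition dsum_scale (k : K) f : dsum := [ffun i => k *: f i].

Fact dsum_addA : associative dsum_add.
Proof. by move=> f g h; apply/ffunP => i; rewrite !ffunE addrA. Qed.
Fact dsum_addC : commutative dsum_add.
Proof. by move=> f g; apply/ffunP => i; rewrite !ffunE addrC. Qed.
Fact dsum_add0 : left_id dsum0 dsum_add.
Proof. by move=> f; apply/ffunP => i; rewrite !ffunE add0r. Qed.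
Fact dsum_addN : left_inverse dsum0 dsum_opp dsum_add.
Proof. by move=> f; apply/ffunP => i; rewrite !ffunE addNr. Qed.
HB.instance Definition _ :=
  GRing.isZmodule.Build dsum dsum_addA dsum_addC dsum_add0 dsum_addN.

Fact dsum_scaleA a b f : dsum_scale a (dsum_scale b f) = dsum_scale (a * b) f.
Proof. by apply/ffunP => i; rewrite !ffunE scalerA. Qed.
Fact dsum_scale1 : left_id 1 dsum_scale.
Proof. by move=> f; apply/ffunP => i; rewrite !ffunE scale1r. Qed.
Fact dsum_scaleDr : right_distributive dsum_scale +%R.
Proof. by move=> a f g; apply/ffunP => i; rewrite !ffunE scalerDr. Qed.
Fact dsum_scaleDl f : {morph dsum_scale^~ f : a b / a + b}.
Proof. by move=> a b; apply/ffunP => i; rewrite !ffunE scalerDl. Qed.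
HB.instance Definition _ := GRing.Zmodule_isLmodule.Build K dsum
  dsum_scaleA dsum_scale1 dsum_scaleDr dsum_scaleDl.

Fact dsum_vect_iso :
  Vector.axiom (\sum_(j < #|I|) dim (T (enum_val j))) dsum.
Proof.
pose fr (f : dsum) := \mxrow_(j < #|I|) v2r (f (enum_val j) : T (enum_val j)).
exists fr.
  by move=> a f g; apply/rowP => j; rewrite !mxE !ffunE linearP !mxE.
pose h (r : 'rV[K]_(\sum_(j < #|I|) dim (T (enum_val j)))) : dsum :=
  [ffun i => ecast i (T i) (enum_rankK i)
     (r2v (submxrow r (enum_rank i)) : T (enum_val (enum_rank i)))].
exists h => [f | r].
  apply/ffunP => i; rewrite ffunE mxrowK v2rK.
  by move: (enum_rankK i); move: (enum_val _) => k ki; case: i / ki.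
apply/mxrowP => j; rewrite mxrowK ffunE; apply: (canLR r2vK).
move: (enum_rankK (enum_val j)) (enum_valK j).
move: (enum_rank _) => k e kj; case: j / kj e => e.
by rewrite (eq_axiomK e).
Qed.
HB.instance Definition _ := Lmodule_hasFinDim.Build K dsum dsum_vect_iso.

Definition dproj_fun i (f : dsum) : T i := f i.
Fact dproj_linear i : linear (dproj_fun i).
Proof. by move=> a f g; rewrite /dproj_fun !ffunE. Qed.
HB.instance Definition _ i :=
  GRing.isLinear.Build K _ _ _ (dproj_fun i) (dproj_linear i).
Definition dproj i : 'Hom(dsum, T i) := linfun (dproj_fun i).

Definition dinj_fun i (x : T i) : dsum := finfun (dfwith (fun j => 0 : T j) x).

Fact dinj_linear i : linear (@dinj_fun i).
Proof.
move=> a x y; apply/ffunP => j; rewrite !ffunE.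
case: (eqVneq i j) => [ij | ij]; last by rewrite !dfwith_out // scaler0 addr0.
by case: j / ij; rewrite !dfwith_in.
Qed.
HB.instance Definition _ i :=
  GRing.isLinear.Build K _ _ _ (@dinj_fun i) (@dinj_linear i).

Definition dinj i : 'Hom(T i, dsum) := linfun (@dinj_fun i).

End DirectSum.

Section ExteriorAlgebra.
Variables (K : fieldType) (n : nat).

(* The exterior algebra of K^n, with basis e_S for S a subset of 'I_n:
   if S = {i_1 < ... < i_k}, then e_S stands for e_{i_1} /\ ... /\ e_{i_k}.
   Hence e_A * e_B = (-1)^(ninv A B) e_{A :|: B} if A and B are disjoint,
   and e_A * e_B = 0 otherwise. *)
Definition extalg := {ffun {set 'I_n} -> K^o}.
HB.instance Definition _ := Vector.on extalg.
Implicit Types (x y z : extalg) (A B S T : {set 'I_n}).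

Definition ninv A B : nat :=
  #|[set p : 'I_n * 'I_n | [&& p.1 \in A, p.2 \in B & (p.2 < p.1)%N]]|.

Definition wedge x y : extalg :=
  [ffun S : {set 'I_n} => \sum_(A : {set 'I_n} | A \subset S)
     (-1) ^+ ninv A (S :\: A) * (x A * y (S :\: A))].

Definition ext1 : extalg := [ffun S : {set 'I_n} => (S == set0)%:R].

Lemma inv0l B : ninv set0 B = 0%N.
Proof. by apply/eqP; rewrite cards_eq0 -subset0; apply/subsetP => p; rewrite !inE. Qed.

Lemma inv0r A : ninv A set0 = 0%N.
Proof.
by apply/eqP; rewrite cards_eq0 -subset0; apply/subsetP => p; rewrite !inE andbF.
Qed.

Lemma invUl A B S : [disjoint A & B] -> ninv (A :|: B) S = (ninv A S + ninv B S)%N.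
Proof.
move=> dAB; rewrite /ninv -cardsUI [X in (_ + X)%N]eq_card0 ?addn0.
  by apply: eq_card => p; rewrite !inE andb_orl.
move=> p; rewrite !inE; apply/negP => /andP[/and3P[pA _ _] /and3P[pB _ _]].
by move/pred0P: dAB => /(_ p.1) /=; rewrite pA pB.
Qed.

Lemma invUr A B S : [disjoint A & B] -> ninv S (A :|: B) = (ninv S A + ninv S B)%N.
Proof.
move=> dAB; rewrite /ninv -cardsUI [X in (_ + X)%N]eq_card0 ?addn0.
  by apply: eq_card => p; rewrite !inE; case: (p.1 \in S); rewrite //= andb_orl.
move=> p; rewrite !inE; apply/negP => /andP[/and3P[_ pA _] /and3P[_ pB _]].
by move/pred0P: dAB => /(_ p.2) /=; rewrite pA pB.
Qed.

Fact wedgeA : associative wedge.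
Proof.
move=> x y z; apply/ffunP => S; rewrite !ffunE.
pose s (k : nat) : K := (-1) ^+ k.
transitivity (\sum_(A : {set 'I_n} | A \subset S)
  \sum_(B : {set 'I_n} | B \subset S :\: A)
   s (ninv A B + ninv A (S :\: A :\: B) + ninv B (S :\: A :\: B))%N
     * (x A * y B * z (S :\: A :\: B))).
  apply: eq_bigr => A AS; rewrite ffunE !mulr_sumr; apply: eq_bigr => B BS.
  have -> : ninv A (S :\: A) = (ninv A B + ninv A (S :\: A :\: B))%N.
    rewrite -invUr ?setDUr; last by rewrite disjoint_sym disjoints_subset subsetDr.
    by rewrite -[in LHS](setID (S :\: A) B) (setIidPr BS).
  by rewrite /s !exprD -!mulrA; do 2 congr (_ * _); rewrite mulrCA.
transitivity (\sum_(Q : {set 'I_n} | Q \subset S)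
  \sum_(A : {set 'I_n} | A \subset Q)
   s (ninv A (Q :\: A) + ninv A (S :\: Q) + ninv (Q :\: A) (S :\: Q))%N
     * (x A * y (Q :\: A) * z (S :\: Q))); last first.
  apply: eq_bigr => Q QS; rewrite ffunE mulr_suml mulr_sumr.
  apply: eq_bigr => A AQ.
  have -> : ninv Q (S :\: Q) = (ninv A (S :\: Q) + ninv (Q :\: A) (S :\: Q))%N.
    rewrite -invUl ?disjoints_subset ?setCD ?subsetUr //.
    by rewrite -{1}(setID Q A) (setIidPr AQ).
  rewrite -addnA /s !exprD -!mulrA mulrCA; congr (_ * _).
  exact: mulrCA.
rewrite [RHS](exchange_big_dep (fun A : {set 'I_n} => A \subset S)) /=; last first.
  by move=> Q A QS AQ; exact: subset_trans AQ QS.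
apply: eq_bigr => A AS.
rewrite (reindex_onto (fun Q : {set 'I_n} => Q :\: A)
  (fun B : {set 'I_n} => A :|: B)) /=; last first.
  move=> B BS; rewrite setDUl setDv set0U; apply/setDidPl.
  by move: BS; rewrite subsetD => /andP[].
apply: eq_big => [Q | Q /andP[QS /eqP QE]].
  apply/andP/andP => [[QS /eqP QE] | [QS AQ]].
    split; last by rewrite -QE subsetUl.
    by rewrite -QE subUset AS (subset_trans QS) ?subsetDl.
  split; first exact: setSD.
  by rewrite -{2}(setID Q A) (setIidPr AQ).
by rewrite setDDl QE.
Qed.

Fact wedge1l : left_id ext1 wedge.
Proof.
move=> x; apply/ffunP => S; rewrite ffunE (bigD1 set0) ?sub0set //= big1.
  by rewrite ffunE eqxx setD0 inv0l !mul1r addr0.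
by move=> A /andP[_ /negPf A0]; rewrite ffunE A0 mul0r mulr0.
Qed.

Fact wedge1r : right_id ext1 wedge.
Proof.
move=> x; apply/ffunP => S; rewrite ffunE (bigD1 S) //= big1.
  by rewrite ffunE setDv eqxx inv0r mul1r mulr1 addr0.
move=> A /andP[AS AnS]; rewrite ffunE setD_eq0.
case SA: (S \subset A); last by rewrite !mulr0.
by move: AnS; rewrite eqEsubset AS SA.
Qed.

Fact wedgeDl : left_distributive wedge +%R.
Proof.
move=> x y z; apply/ffunP => S; rewrite !ffunE -big_split /=.
by apply: eq_bigr => A _; rewrite !ffunE mulrDl mulrDr.
Qed.

Fact wedgeDr : right_distributive wedge +%R.
Proof.
move=> x y z; apply/ffunP => S; rewrite !ffunE -big_split /=.
by apply: eq_bigr => A _; rewrite !ffunE !mulrDr.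
Qed.

Fact ext1_neq0 : ext1 != 0.
Proof. by apply/eqP => /ffunP/(_ set0)/eqP; rewrite !ffunE eqxx oner_eq0. Qed.

HB.instance Definition _ := GRing.Zmodule_isNzRing.Build extalg
  wedgeA wedge1l wedge1r wedgeDl wedgeDr ext1_neq0.

Fact wedgeZl (a : K) x y : a *: (x * y) = (a *: x) * y.
Proof.
apply/ffunP => S; rewrite !ffunE scaler_sumr; apply: eq_bigr => A _.
by rewrite !ffunE -[a *: _]/(a * _) -[a *: x A]/(a * x A) mulrCA -!mulrA.
Qed.
HB.instance Definition _ := GRing.Lmodule_isLalgebra.Build K extalg wedgeZl.

Fact wedgeZr (a : K) x y : a *: (x * y) = x * (a *: y).
Proof.
apply/ffunP => S; rewrite !ffunE scaler_sumr; apply: eq_bigr => A _.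
by rewrite !ffunE -[a *: _]/(a * _) -[a *: y _]/(a * y _) mulrCA (mulrCA a).
Qed.
HB.instance Definition _ := GRing.Lalgebra_isAlgebra.Build K extalg wedgeZr.
HB.instance Definition _ := Algebra_isFalgebra.Build K extalg.

Definition extvec (v : 'rV[K]_n) : extalg :=
  [ffun S : {set 'I_n} => \sum_(i < n | S == [set i]) v 0 i].

Fact extvec_linear : linear extvec.
Proof.
move=> a u v; apply/ffunP => S; rewrite !ffunE scaler_sumr -big_split /=.
by apply: eq_bigr => i _; rewrite !mxE.
Qed.
HB.instance Definition _ := GRing.isLinear.Build K _ _ _ extvec extvec_linear.

(* The exterior powers and the exterior algebra of a subspace W of K^n, as
   subspaces of the exterior algebra of K^n. *)
Definition extpow (j : nat) (W : {vspace 'rV[K]_n}) : {vspace extalg} :=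
  ((linfun extvec @: W) ^+ j)%VS.

Definition ext (W : {vspace 'rV[K]_n}) : {vspace extalg} :=
  (\sum_(j < n.+1) extpow j W)%VS.

(* The algebra endomorphism induced by a linear endomorphism f of K^n; the
   product is taken in increasing order of i. *)
Definition extmap (f : 'rV[K]_n -> 'rV[K]_n) (x : extalg) : extalg :=
  \sum_(S : {set 'I_n}) x S *: \prod_(i in S) extvec (f (delta_mx 0 i)).

Fact extmap_linear f : linear (extmap f).
Proof.
move=> a x y; rewrite /extmap scaler_sumr -big_split /=.
by apply: eq_bigr => S _; rewrite !ffunE scalerDl scalerA.
Qed.
HB.instance Definition _ f :=
  GRing.isLinear.Build K _ _ _ (extmap f) (extmap_linear f).

End ExteriorAlgebra.

Section InducedModule.
Variables (K : fieldType) (n : nat) (H : {set 'S_n}).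
Variables (V : vectType K) (rho : 'S_n -> 'End(V)).

(* The composite g o h; mathcomp's group law on permutations is the opposite
   one: (h * g)%g i = g (h i). *)
Definition permcomp (g h : 'S_n) : 'S_n := (h * g)%g.

(* K[S_n] (x)_K V is represented by the functions from S_n to V, and
   ftens g v is g (x) v. *)
Definition ftens (g : 'S_n) (v : V) : {ffun 'S_n -> V} :=
  [ffun g' => if g' == g then v else 0].

Fact ftens_linear g : linear (ftens g).
Proof.
move=> a u v; apply/ffunP => g'; rewrite !ffunE.
by case: eqP; rewrite ?scaler0 ?addr0.
Qed.
HB.instance Definition _ g :=
  GRing.isLinear.Build K _ _ _ (ftens g) (ftens_linear g).

(* The span of the (g o h) (x) v - g (x) (h v) with h in H. *)
Definition indrel : {vspace {ffun 'S_n -> V}} :=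
  (\sum_(g : 'S_n) \sum_(h in H)
     limg (linfun (ftens (permcomp g h)) - (linfun (ftens g) \o rho h)%VF))%VS.

(* K[S_n] (x)_{K[H]} V *)
Definition indmod : vectType K := quotv indrel.

Definition tens (g : 'S_n) : 'Hom(V, indmod) :=
  (qpi indrel \o linfun (ftens g))%VF.

Definition feval_fun (g : 'S_n) (f : {ffun 'S_n -> V}) : V := f g.
Fact feval_linear g : linear (feval_fun g).
Proof. by move=> a f f'; rewrite /feval_fun !ffunE. Qed.
HB.instance Definition _ g :=
  GRing.isLinear.Build K _ _ _ (feval_fun g) (feval_linear g).

(* The coefficient of g in the chosen representative in K[S_n] (x)_K V *)
Definition tcoef (g : 'S_n) : 'Hom(indmod, V) :=
  (linfun (feval_fun g) \o qrepr indrel)%VF.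

Lemma tens_tcoef y : y = \sum_g tens g (tcoef g y).
Proof.
rewrite -[LHS]qreprK; set f := qrepr _ y.
have {1}-> : f = \sum_g ftens g (f g).
  apply/ffunP => g; rewrite sum_ffunE (bigD1 g) //= ffunE eqxx big1 ?addr0 //.
  by move=> g' /negPf ng; rewrite ffunE eq_sym ng.
rewrite linear_sum; apply: eq_bigr => g _.
rewrite /tens /tcoef !comp_lfunE; congr (qpi _ _).
by rewrite [RHS]lfunE [in RHS]lfunE.
Qed.

(* s (g (x) v) = (s o g) (x) v *)
Definition indact (s : 'S_n) : 'End(indmod) :=
  \sum_(g : 'S_n) (tens (permcomp s g) \o tcoef g)%VF.

End InducedModule.

(* A graph on the vertex set 'I_n with m edges, enumerated by 'I_m; an edge is
   given by its two ends, in an irrelevant order.  Loops and multiple edges are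
   allowed. *)
Definition multigraph (n m : nat) := m.-tuple ('I_n * 'I_n).

Section ChromaticHomology.
Variables (C : numClosedFieldType) (n m : nat) (G : multigraph n m).
(* Spanning subgraphs, in particular states, are sets of edges. *)
Implicit Types (F A : {set 'I_m}) (e : 'I_m) (i j : nat).

Definition joins e (u v : 'I_n) : bool :=
  (tnth G e == (u, v)) || (tnth G e == (v, u)).

Definition triangle (e1 e2 e3 : 'I_m) : Prop :=
  exists u v w : 'I_n, [/\ u != v, v != w & u != w] /\
    [/\ joins e1 u v, joins e2 v w & joins e3 u w].

Definition adj F : rel 'I_n := [rel u v | [exists e in F, joins e u v]].

Definition components F : {set {set 'I_n}} :=
  equivalence_partition (connect (adj F)) [set: 'I_n].

(* The Young subgroup S_F, product of the symmetric groups of the components *)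
Definition youngS F : {set 'S_n} :=
  [set g : 'S_n | [forall B in components F, g @: B == B]].

Definition entry_fun (v : 'I_n) (x : 'rV[C]_n) : C^o := x 0 v.
Fact entry_linear v : linear (entry_fun v).
Proof. by move=> a x y; rewrite /entry_fun !mxE. Qed.
HB.instance Definition _ v :=
  GRing.isLinear.Build C _ _ _ (entry_fun v) (entry_linear v).
Definition entry (v : 'I_n) : 'Hom('rV[C]_n, C^o) := linfun (entry_fun v).

Definition Wset (B : {set 'I_n}) : {vspace 'rV[C]_n} :=
  ((\bigcap_(v | v \notin B) lker (entry v)) :&:
     lker (\sum_(v in B) entry v)%R)%VS.

Lemma mem_Wset (B : {set 'I_n}) (x : 'rV[C]_n) :
  reflect ((forall v, v \notin B -> x 0 v = 0) /\ \sum_(v in B) x 0 v = 0)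
          (x \in Wset B).
Proof.
rewrite /Wset memv_cap memv_ker sum_lfunE.
have -> : \sum_(v in B) entry v x = \sum_(v in B) x 0 v :> C.
  by apply: eq_bigr => v _; rewrite lfunE.
apply: (iffP andP) => [[+ /eqP ->] | [xB ->]].
  rewrite memvE => /subv_bigcapP xB; split=> // v /xB.
  by rewrite -memvE memv_ker lfunE => /eqP.
rewrite eqxx memvE; split=> //; apply/subv_bigcapP => v vB.
by rewrite -memvE memv_ker lfunE; apply/eqP/xB.
Qed.

Definition Wstate F : {vspace 'rV[C]_n} := (\sum_(B in components F) Wset B)%VS.

Definition orthv (W : {vspace 'rV[C]_n}) : {vspace 'rV[C]_n} :=
  (\bigcap_(w <- vbasis W) lker (\sum_(v < n) (w 0 v)^* *: entry v)%R)%VS.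

Definition orthproj (W : {vspace 'rV[C]_n}) : 'End('rV[C]_n) :=
  daddv_pi W (orthv W).

(* The action of S_n on C^n: g e_v = e_(g v) *)
Definition permv (g : 'S_n) (x : 'rV[C]_n) : 'rV[C]_n :=
  \row_v x 0 (g^-1%g v).

Definition extstate F : {vspace extalg C n} := ext (Wstate F).

Definition extact F (g : 'S_n) : 'End(subvs_of (extstate F)) :=
  linfun (vsproj (extstate F) \o extmap (permv g) \o vsval).

Definition Mmod F : vectType C := indmod (youngS F) (extact F).

(* g (x) x in M_F, for x in the exterior algebra of W_F *)
Definition Mtens F (g : 'S_n) : 'Hom(extalg C n, Mmod F) :=
  (tens (youngS F) (extact F) g \o linfun (vsproj (extstate F)))%VF.

Definition Mdeg F j : {vspace Mmod F} :=
  (\sum_(g : 'S_n) (Mtens F g @: extpow j (Wstate F)))%VS.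

(* d_eps (g (x) x) = \sum_h (g o h) (x) (ext pi) (h^-1 x), with h ranging over
   representatives of the left cosets of S_F' in S_F: these are right cosets
   for mathcomp's law.  This is the identity if F and F' = F - e have the same
   components. *)
Definition dedge F e : 'Hom(Mmod F, Mmod (F :\ e)) :=
  \sum_(g : 'S_n) \sum_(D in rcosets (youngS (F :\ e)) (youngS F))
    (Mtens (F :\ e) (permcomp g (repr D))
      \o linfun (extmap (orthproj (Wstate (F :\ e))))
      \o linfun (extmap (permv (repr D)^-1%g))
      \o linfun (@vsval _ _ (extstate F))
      \o tcoef (youngS F) (extact F) g)%VF.

Definition chain : vectType C := dsum Mmod.

Definition Cmod A i j : {vspace chain} :=
  (\sum_(F : {set 'I_m} | (F \subset A) && (#|F| == i))
     dinj Mmod F @: Mdeg F j)%VS.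

(* The differential of the whole complex; on the chains of a spanning subgraph
   A, it only involves edges of A. *)
Definition diff : 'End(chain) :=
  \sum_(F : {set 'I_m}) \sum_(e in F)
    (-1) ^+ #|[set f in F | (e < f)%N]| *:
      (dinj Mmod (F :\ e) \o dedge F e \o dproj Mmod F)%VF.

Definition chact (s : 'S_n) : 'End(chain) :=
  \sum_(F : {set 'I_m})
    (dinj Mmod F \o indact (youngS F) (extact F) s \o dproj Mmod F)%VF.

Definition cycles A i j : {vspace chain} := (Cmod A i j :&: lker diff)%VS.
Definition boundaries A i j : {vspace chain} := (diff @: Cmod A i.+1 j)%VS.

Definition Hdeg A i j : vectType C :=
  quotv (linfun (@vsval _ _ (cycles A i j)) @^-1: boundaries A i j)%VS.

Definition Hdeg_class A i j : 'Hom(chain, Hdeg A i j) :=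
  (qpi _ \o linfun (vsproj (cycles A i j)))%VF.

Definition Hdeg_repr A i j (y : Hdeg A i j) : chain := vsval (qrepr _ y).

(* H_i(A), as the direct sum of the H_{i,j}(A); the exterior powers of degree j > n vanish. *)
Definition homology A i : vectType C := dsum (fun j : 'I_n.+1 => Hdeg A i j).

(* The class of a family of cycles, the j-th one having degree j *)
Definition Hclass A i (x : 'I_n.+1 -> chain) : homology A i :=
  [ffun j : 'I_n.+1 => Hdeg_class A i j (x j)].

Definition Hact A i (s : 'S_n) (y : homology A i) : homology A i :=
  Hclass A i (fun j : 'I_n.+1 => chact s (Hdeg_repr (y j))).

Definition homogeneous A i (j : 'I_n.+1) (y : homology A i) : Prop :=
  forall k : 'I_n.+1, k != j -> y k = 0.

End ChromaticHomology.

Definition exact_at (K : fieldType) (U V W : vectType K)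
    (f : 'Hom(U, V)) (g : 'Hom(V, W)) : Prop :=
  limg f = lker g.

(* Main.v *)
(* A = G - e1 and B = G - e2: the chains of A and of B intersect in those of
   A :&: B, and together they span the chains vanishing at all states that
   contain e1 and e2.  The remaining states come in pairs F, F - e3, and because
   e1, e2, e3 form a triangle, F and F - e3 have the same components, so that the
   per-edge map between them is an isomorphism.  Hence C(G) / (C(A) + C(B)) is
   contractible, and the Mayer-Vietoris sequence of C(A) + C(B) computes H(G).

   All per-edge maps are instances of a map M_F -> M_F' defined for any two
   states and functorial along refinements of the components; this gives both
   d o d = 0 and the inverse of the per-edge map F -> F - e3. *)
From HB Require Import structures.
Require Import Defs.
From mathcomp Require Import all_boot all_order all_fingroup all_algebra all_field.
From mathcomp Require Import reals complex.

Set Implicit Arguments.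
Unset Strict Implicit.
Unset Printing Implicit Defensive.

Import Order.TTheory GRing.Theory Num.Theory.
Local Open Scope ring_scope.

(** * Functoriality of the exterior algebra *)

(** The modules M_F and the homology modules are quotients with chosen complements of
    representatives. A linear map out of one of them is therefore written through representatives,
    and its value on generators or cycles is a theorem: [indlift_tens], [incl_cl] and
    [connecting_cl]. The contraction and the splitting of C(A) + C(B) are endomorphisms of the whole
    chain space, not existence statements, so that the connecting map is linear by construction.

    Functoriality of the maps M_F -> M_F' rests on the choice of orthogonal projections for a
    permutation-invariant Hermitian form: they compose along nested subspaces and commute with the
    Young subgroups. The states F and F - e3 refine each other, so both round trips are maps from a
    state to itself, which are identities. All this happens in one exterior degree j <= n at a time;
    direct sums are taken last. *)

Section ExteriorMaps.
Variables (K : numFieldType) (n : nat).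
Local Notation rV := 'rV[K]_n.
Implicit Types (x y : extalg K n) (S : {set 'I_n}) (u v : rV) (W : {vspace rV}).

Definition extbase S : extalg K n := [ffun T : {set 'I_n} => (T == S)%:R].

Lemma extalg_base x : x = \sum_S x S *: extbase S.
Proof.
apply/ffunP => T; rewrite sum_ffunE (bigD1 T) //= big1 ?addr0.
  by rewrite !ffunE eqxx -[_ *: _]/(_ * _) mulr1.
by move=> S /negPf ST; rewrite !ffunE eq_sym ST scaler0.
Qed.

Lemma extvec_delta i : extvec (delta_mx 0 i : rV) = extbase [set i].
Proof.
apply/ffunP => S; rewrite !ffunE.
under eq_bigr => j _ do rewrite mxE eqxx /=.
have [-> | Si] := eqVneq S [set i].
  rewrite (bigD1 i) //= eqxx big1 ?addr0 // => j /andP[_ /negPf ji].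
  by rewrite ji.
apply: big1 => j /eqP Sj; case: eqP => // ji.
by move: Si; rewrite Sj ji eqxx.
Qed.

Lemma extvec_base v : extvec v = \sum_i v 0 i *: extbase [set i].
Proof.
rewrite {1}(row_sum_delta v) linear_sum; apply: eq_bigr => i _.
by rewrite linearZ /= extvec_delta.
Qed.

Lemma extbase1_mul i S :
  extbase [set i] * extbase S =
  if i \in S then 0 else (-1) ^+ ninv [set i] S *: extbase (i |: S).
Proof.
apply/ffunP => T; rewrite -[_ * _]/(wedge _ _) ffunE.
under eq_bigr => A _ do rewrite !ffunE.
rewrite big_mkcond (bigD1 [set i]) //= big1 ?addr0; last first.
  by move=> A /negPf Ai; rewrite Ai mul0r mulr0; case: ifP.
rewrite sub1set eqxx mul1r.
case iS: (i \in S).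
  rewrite [RHS]ffunE; case: ifP => // iT; case: eqP => [TS|]; last by rewrite mulr0.
  by move: iS; rewrite -TS !inE eqxx.
rewrite !ffunE -[RHS]/(_ * _); have [-> | TS] := eqVneq T (i |: S).
  by rewrite setU11 setU1K ?iS // eqxx.
rewrite mulr0; case: ifP => // iT; case: eqP => [TiS|]; last by rewrite mulr0.
by move: TS; rewrite -TiS setD1K ?eqxx.
Qed.

Lemma extvec_anticomm u v : extvec u * extvec v = - (extvec v * extvec u).
Proof.
rewrite !extvec_base !mulr_suml -sumrN.
under eq_bigr => i _ do rewrite mulr_sumr.
under [RHS]eq_bigr => i _ do rewrite mulr_sumr -sumrN.
rewrite [RHS]exchange_big; apply: eq_bigr => i _; apply: eq_bigr => j _ /=.
rewrite -!scalerAl -!scalerAr !scalerA [_ * u _ _]mulrC -scalerN; congr (_ *: _).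
rewrite !extbase1_mul !inE eq_sym; case: eqVneq => [_|ij]; first by rewrite oppr0.
rewrite setUC -scaleNr; congr (_ *: _).
have E (a b : 'I_n) : a != b -> ninv [set a] [set b] = (b < a)%N.
  move=> ab; rewrite /ninv; case: ltnP => ba.
    rewrite (_ : [set _ | _] = [set (a, b)]) ?cards1 //.
    apply/setP => -[p q]; rewrite !inE /= xpair_eqE.
    by case: eqP => //= ->; case: eqP => //= ->; rewrite ba.
  apply/eqP; rewrite cards_eq0 -subset0; apply/subsetP => -[p q].
  rewrite !inE /=; case: eqP => //= ->; case: eqP => //= ->.
  by rewrite ltnNge ba.
rewrite !E // 1?eq_sym //; case: (ltngtP i j) => [||/val_inj ij'].
- by rewrite expr0 expr1 opprK.
- by rewrite expr0 expr1.
by rewrite ij' eqxx in ij.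
Qed.

Lemma extvec_sq u : extvec u * extvec u = 0.
Proof.
have /eqP := extvec_anticomm u u; rewrite -addr_eq0 -mulr2n -scaler_nat.
by rewrite scaler_eq0 pnatr_eq0 => /eqP.
Qed.

Lemma extvec_prod_comm (I : Type) (r : seq I) (P : pred I) (w : I -> rV) u :
  extvec u * \prod_(i <- r | P i) extvec (w i) =
  (-1) ^+ count P r *: (\prod_(i <- r | P i) extvec (w i) * extvec u).
Proof.
elim: r => [|i r IH]; first by rewrite !big_nil mulr1 mul1r scale1r.
rewrite !big_cons /=; case: (P i) => //=.
rewrite mulrA extvec_anticomm mulNr -[_ * extvec u * _]mulrA IH -scalerAr.
by rewrite exprS mulN1r scaleNr mulrA.
Qed.

(** The product runs in increasing order, so moving [extvec (w i)] into place passes exactly the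
    factors of [S] below [i], [ninv [set i] S] in number; a second occurrence of [i] produces a
    square, hence 0. This is the rule [extbase1_mul] for arbitrary vectors, and it makes [extmap]
    multiplicative. *)
Lemma extvec_mul_prod (w : 'I_n -> rV) i S :
  extvec (w i) * \prod_(k in S) extvec (w k) =
  if i \in S then 0
  else (-1) ^+ ninv [set i] S *: \prod_(k in i |: S) extvec (w k).
Proof.
have [s1 [s2 [eE lt1 gt2]]] : exists s1 s2 : seq 'I_n,
    [/\ index_enum 'I_n = s1 ++ i :: s2,
      all (fun k : 'I_n => k < i)%N s1 & all (fun k : 'I_n => i < k)%N s2].
  have us : sorted ltn (map val (index_enum 'I_n)).
    by rewrite /index_enum -enumT val_enum_ord iota_ltn_sorted.
  have ii : i \in index_enum 'I_n by rewrite mem_index_enum.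
  move: us; case/splitPr: ii => s1 s2; rewrite map_cat /= => us.
  exists s1, s2; split=> //; move: us;
    rewrite (sorted_pairwise ltn_trans) pairwise_cat /= => /and3P[].
    move=> + _ _; rewrite allrelC => /allP/(_ _ (mem_head _ _)).
    by rewrite /= all_map.
  by move=> _ _ /andP[]; rewrite all_map.
(* The list [s1] holds the indices below [i], so the inversions are the pairs [(i, k)] with [k] in
   [S] and in [s1]. *)
have ninvE : ninv [set i] S = count (mem S) s1.
  have u1 : uniq (s1 ++ i :: s2) by rewrite -eE index_enum_uniq.
  have -> : count (mem S) s1 = #|[set k | (k \in S) && (k \in s1)]|.
    rewrite -size_filter -(card_uniqP _); last first.
      by rewrite filter_uniq //; move: u1; rewrite cat_uniq => /and3P[].
    by apply: eq_card => k; rewrite mem_filter !inE.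
  rewrite /ninv -[RHS](card_imset _ (can_inj (g := snd) (f := fun k => (i, k)) _)) //.
  apply: eq_card => -[p q]; rewrite !inE /=.
  apply/and3P/imsetP => [[/eqP -> qS qi]|[k]].
    exists q => //; rewrite inE qS; have := mem_index_enum q.
    rewrite eE mem_cat inE; case/or3P => //.
      by move=> /eqP qi'; rewrite qi' ltnn in qi.
    by move/(allP gt2) => /ltn_trans/(_ qi); rewrite ltnn.
  by rewrite inE => /andP[kS /(allP lt1) ki] [-> ->].
rewrite eE !big_cat !big_cons /= setU11 mulrA extvec_prod_comm ninvE.
case: ifP => iS.
  by rewrite -scalerAl -mulrA [extvec _ * (_ * _)]mulrA extvec_sq mul0r mulr0 scaler0.
rewrite -scalerAl -mulrA; congr (_ *: (_ * (_ * _))).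
  rewrite big_seq_cond [RHS]big_seq_cond; apply: eq_bigl => k; rewrite !inE.
  by case: eqP => [->|//]; case ks: (i \in s1) => //=; move/(allP lt1): ks; rewrite ltnn.
rewrite big_seq_cond [RHS]big_seq_cond; apply: eq_bigl => k; rewrite !inE.
by case: eqP => [->|//]; case ks: (i \in s2) => //=; move/(allP gt2): ks; rewrite ltnn.
Qed.

Lemma extmap_base (f : rV -> rV) S :
  extmap f (extbase S) = \prod_(i in S) extvec (f (delta_mx 0 i)).
Proof.
rewrite /extmap (bigD1 S) //= [X in _ + X]big1 ?addr0 => [|T /negPf TS].
  by rewrite ffunE eqxx scale1r.
by rewrite ffunE TS scale0r.
Qed.

Lemma extmap1 (f : rV -> rV) : extmap f 1 = 1.
Proof.
have -> : 1 = extbase set0 by apply/ffunP => S; rewrite !ffunE.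
by rewrite extmap_base big_set0; apply/ffunP => S; rewrite !ffunE.
Qed.

(** Exterior powers are generated from 1 by left multiplication with vectors of [W]. Taking for [P]
    a kernel or a preimage reduces claims about [extmap] to a single vector factor. *)
Lemma extpow_ind j (W : {vspace rV}) (P : nat -> {vspace extalg K n}) :
  1 \in P 0%N -> 
  (forall k v y, v \in W -> y \in P k -> extvec v * y \in P k.+1) ->
  (extpow j W <= P j)%VS.
Proof.
move=> P0 PS; rewrite /extpow; elim: j => [|j IH]; first by rewrite expv0 -memvE.
rewrite expvSl; apply/prodvP => u y /memv_imgP[v vW ->] yj.
by rewrite lfunE; apply: PS => //; apply: subvP IH _ _.
Qed.

Lemma extpow_mul j (W : {vspace rV}) v y :
  v \in W -> y \in extpow j W -> extvec v * y \in extpow j.+1 W.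
Proof.
move=> vW yj; rewrite /extpow expvSl memv_mul //.
by rewrite -[extvec v]lfunE memv_img.
Qed.

Lemma ext_sum (W : {vspace rV}) x : x \in ext W ->
  exists2 y : 'I_n.+1 -> extalg K n, (forall j : 'I_n.+1, y j \in extpow j W) &
    x = \sum_j y j.
Proof. by case/memv_sumP => y yP ->; exists y => // j; apply: yP. Qed.

Lemma extpow_ext (j : 'I_n.+1) (W : {vspace rV}) : (extpow j W <= ext W)%VS.
Proof. exact: (sumv_sup j). Qed.

Section Functor.
Variable f : {linear rV -> rV}.

(** Both sides are linear in [v] and in [y]; on basis elements, [extbase1_mul] and [extvec_mul_prod]
    give the same sign and the same vanishing. *)
Lemma extmap_vec_mul v y : extmap f (extvec v * y) = extvec (f v) * extmap f y.
Proof.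
rewrite {2}[v]row_sum_delta extvec_base !linear_sum !mulr_suml linear_sum.
apply: eq_bigr => i _; rewrite !linearZ /= -!scalerAl linearZ /=; congr (_ *: _).
rewrite [y]extalg_base mulr_sumr !linear_sum /= mulr_sumr; apply: eq_bigr => S _.
rewrite -scalerAr !linearZ /= -scalerAr extbase1_mul extmap_base.
rewrite (extvec_mul_prod (fun i => f (delta_mx 0 i))); case: ifP => _.
  by rewrite linear0.
by rewrite linearZ /= extmap_base.
Qed.

Lemma extmap_prod_vec (I : Type) (r : seq I) (P : pred I) (w : I -> rV) :
  extmap f (\prod_(i <- r | P i) extvec (w i)) =
  \prod_(i <- r | P i) extvec (f (w i)).
Proof.
elim: r => [|i r IH]; first by rewrite !big_nil extmap1.
by rewrite !big_cons; case: (P i) => //; rewrite extmap_vec_mul IH.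
Qed.

(** [extmap g] reads [g] only on the standard basis, where it produces products of vectors; [f]
    passes through these by [extmap_prod_vec]. *)
Lemma extmap_comp (g : rV -> rV) x : extmap f (extmap g x) = extmap (f \o g) x.
Proof.
rewrite /extmap -!/(extmap _ _) linear_sum; apply: eq_bigr => S _.
by rewrite linearZ /= extmap_prod_vec.
Qed.

Lemma extpow_map j (W W' : {vspace rV}) x :
  (forall v, v \in W -> f v \in W') ->
  x \in extpow j W -> extmap f x \in extpow j W'.
Proof.
move=> fW xj; rewrite -[extmap f x]lfunE memv_preim; apply: (subvP _ _ xj).
apply: (@extpow_ind j W (fun k => (linfun (extmap f) @^-1: extpow k W')%VS)).
  by rewrite /= -memv_preim lfunE /= extmap1 /extpow expv0 memv_line.
move=> k v y vW /=; rewrite -!memv_preim !lfunE /= => yk.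
by rewrite extmap_vec_mul extpow_mul ?fW.
Qed.

Lemma extmap_id_on j (W : {vspace rV}) x :
  (forall v, v \in W -> f v = v) -> x \in extpow j W -> extmap f x = x.
Proof.
move=> fW xj.
have kerE y : (y \in lker (linfun (extmap f) - \1)%VF) = (extmap f y == y).
  by rewrite memv_ker add_lfunE opp_lfunE id_lfunE lfunE subr_eq0.
have : x \in lker (linfun (extmap f) - \1)%VF.
  apply: (subvP _ _ xj).
  apply: (@extpow_ind j W (fun k => lker (linfun (extmap f) - \1)%VF)).
    by rewrite kerE extmap1.
  by move=> k v y vW /=; rewrite !kerE extmap_vec_mul fW // => /eqP ->.
by rewrite kerE => /eqP.
Qed.

Lemma ext_map (W W' : {vspace rV}) x :
  (forall v, v \in W -> f v \in W') -> x \in ext W -> extmap f x \in ext W'.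
Proof.
move=> fW /ext_sum[y yP ->]; rewrite linear_sum rpred_sum // => j _.
by apply: (subvP (extpow_ext _ _)); apply: extpow_map fW (yP j).
Qed.

Lemma ext_map_id (W : {vspace rV}) x :
  (forall v, v \in W -> f v = v) -> x \in ext W -> extmap f x = x.
Proof.
move=> fW /ext_sum[y yP ->]; rewrite linear_sum; apply: eq_bigr => j _.
exact: extmap_id_on fW (yP j).
Qed.
End Functor.

Lemma eq_extmap (f g : rV -> rV) x : f =1 g -> extmap f x = extmap g x.
Proof.
move=> fg; apply: eq_bigr => S _; congr (_ *: _).
by apply: eq_bigr => i _; rewrite fg.
Qed.

End ExteriorMaps.

(** * Orthogonal projections *)

Section OrthogonalProjection.
Variables (C : numClosedFieldType) (n : nat).
Local Notation rV := 'rV[C]_n.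
Implicit Types (x y : rV) (W : {vspace rV}).

Definition herm x y : C := \sum_(v < n) (x 0 v)^* * y 0 v.

Lemma herm_eq0 x : herm x x = 0 -> x = 0.
Proof.
move=> /eqP; rewrite psumr_eq0 => [/allP x0|v _]; last first.
  by rewrite mulrC mul_conjC_ge0.
apply/rowP => v; rewrite mxE; apply/eqP; rewrite -mul_conjC_eq0 mulrC.
exact: x0 (mem_index_enum _).
Qed.

Lemma hermDl a x x' y : herm (a *: x + x') y = a^* * herm x y + herm x' y.
Proof.
rewrite /herm mulr_sumr -big_split; apply: eq_bigr => v _ /=.
by rewrite !mxE rmorphD rmorphM mulrDl mulrA.
Qed.

Lemma herm_sum_entry x y :
  (\sum_(v < n) (x 0 v)^* *: entry C v)%R y = herm x y :> C^o.
Proof.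
rewrite sum_lfunE; apply: eq_bigr => v _; rewrite scale_lfunE lfunE.
by [].
Qed.

Lemma mem_orthvE W y : (y \in orthv W) = all (fun w => herm w y == 0) (vbasis W).
Proof.
rewrite /orthv; elim: (tval (vbasis W)) => [|w s IH]; first by rewrite big_nil memvf.
by rewrite big_cons memv_cap IH /= memv_ker herm_sum_entry.
Qed.

Lemma mem_orthv W y : reflect (forall x, x \in W -> herm x y = 0) (y \in orthv W).
Proof.
apply: (iffP idP) => [yW x xW | yW].
  rewrite (coord_vbasis xW).
  have b0 (i : 'I_(\dim W)) : herm (vbasis W)`_i y = 0.
    move: yW; rewrite mem_orthvE => /allP/(_ (vbasis W)`_i) /=.
    by rewrite mem_nth ?size_tuple // => /(_ isT)/eqP.
  elim/big_rec: _ => [|i z _ z0]; last by rewrite hermDl b0 z0 mulr0 addr0.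
  by rewrite /herm big1 // => v _; rewrite mxE rmorph0 mul0r.
by rewrite mem_orthvE; apply/allP => w wW; rewrite yW // vbasis_mem.
Qed.

Lemma orthv_cap0 W : (W :&: orthv W = 0)%VS.
Proof.
apply/eqP; rewrite -subv0; apply/subvP => x; rewrite memv_cap memv0.
by case/andP => xW /mem_orthv/(_ x xW)/herm_eq0 ->.
Qed.

Lemma dim_cap_lker (U : {vspace rV}) (f : 'Hom(rV, C^o)) :
  (\dim U <= (\dim (U :&: lker f)).+1)%N.
Proof.
have := dimvS (subvf (f @: U)); rewrite dimvf /= => le1.
by rewrite -(limg_ker_dim f U) (leq_trans (leq_add (leqnn _) le1)) // addn1.
Qed.

(** Dimension count: [orthv W] is cut out by [\dim W] functionals, each lowering the dimension by at
    most one, and it meets [W] trivially because [herm] is definite. *)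
Lemma orthv_full W : (W + orthv W = fullv)%VS.
Proof.
apply/eqP; rewrite eqEdim subvf dimv_disjoint_sum ?orthv_cap0 //.
have le (s : seq rV) : (\dim {:rV} <=
    \dim (\bigcap_(w <- s) lker (\sum_(v < n) (w 0 v)^* *: entry C v)%R)%VS +
      size s)%N.
  elim: s => [|w s IH]; first by rewrite big_nil addn0.
  rewrite big_cons /= addnS -addSn (leq_trans IH) // leq_add2r capvC.
  exact: dim_cap_lker.
by have := le (vbasis W); rewrite size_tuple addnC.
Qed.

Lemma orthproj_decomp W x : orthproj W x \in W /\ x - orthproj W x \in orthv W.
Proof.
split; first exact: memv_pi.
have xf : x \in (W + orthv W)%VS by rewrite orthv_full memvf.
by rewrite -{1}(daddv_pi_add (orthv_cap0 W) xf) addrAC subrr add0r memv_pi.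
Qed.

Lemma orthproj_uniq W x y : y \in W -> x - y \in orthv W -> orthproj W x = y.
Proof.
move=> yW xyW; have [pW xpW] := orthproj_decomp W x.
apply/eqP; rewrite -subr_eq0 -memv0 -(orthv_cap0 W) memv_cap rpredB //=.
have -> : orthproj W x - y = (x - y) - (x - orthproj W x).
  by rewrite opprB [RHS]addrC addrA subrK.
by rewrite rpredB.
Qed.

Lemma orthproj_mem W x : orthproj W x \in W.
Proof. by case: (orthproj_decomp W x). Qed.

Lemma orthproj_id W x : x \in W -> orthproj W x = x.
Proof. by move=> xW; apply: orthproj_uniq; rewrite ?subrr ?mem0v. Qed.

(** The remainder [x - orthproj W x] is orthogonal to [W], hence to the smaller [W']. *)
Lemma orthproj_comp W W' x : (W' <= W)%VS ->
  orthproj W' (orthproj W x) = orthproj W' x.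
Proof.
move=> /subvP sW; have [p'W xpW'] := orthproj_decomp W' x.
apply: orthproj_uniq => //; rewrite -(subrKA x) -opprB addrC rpredB //.
have [_ /mem_orthv xpW] := orthproj_decomp W x.
by apply/mem_orthv => y /sW/xpW.
Qed.

Fact permv_linear (g : 'S_n) : linear (@permv C n g).
Proof. by move=> a x y; apply/rowP => v; rewrite !mxE. Qed.
HB.instance Definition _ g :=
  GRing.isLinear.Build C _ _ _ (@permv C n g) (permv_linear g).

Lemma permvM (g h : 'S_n) x : permv (permcomp g h) x = permv g (permv h x).
Proof. by apply/rowP => v; rewrite !mxE /permcomp invMg permM. Qed.

Lemma permv1 x : permv 1 x = x.
Proof. by apply/rowP => v; rewrite !mxE invg1 perm1. Qed.

Lemma herm_permv (g : 'S_n) x y : herm (permv g x) (permv g y) = herm x y.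
Proof.
rewrite /herm (reindex_inj (@perm_inj _ g)); apply: eq_bigr => v _.
by rewrite !mxE permK.
Qed.

(** Permutations preserve [herm]; if [g] and its inverse stabilise [W], then [g] also stabilises the
    orthogonal complement. *)
Lemma orthproj_permv W (g : 'S_n) x :
  (forall y, y \in W -> permv g y \in W) ->
  (forall y, y \in W -> permv g^-1 y \in W) ->
  orthproj W (permv g x) = permv g (orthproj W x).
Proof.
move=> gW gVW; have [pW /mem_orthv xpW] := orthproj_decomp W x.
apply: orthproj_uniq; first exact: gW.
apply/mem_orthv => y /gVW yW; rewrite -linearB /= -(xpW _ yW) -[RHS](herm_permv g).
by rewrite -permvM /permcomp mulVg permv1.
Qed.

End OrthogonalProjection.

(** * Quotients and maps out of induced modules *)

Lemma qpi_eq0 (K : fieldType) (U : vectType K) (W : {vspace U}) u :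
  (qpi W u == 0) = (u \in W).
Proof. by rewrite -memv_ker lker_qpi. Qed.

Lemma qrepr_qpi (K : fieldType) (U : vectType K) (W : {vspace U}) u :
  qrepr W (qpi W u) - u \in W.
Proof. by rewrite -qpi_eq0 linearB /= qreprK subrr. Qed.

Lemma comp_linfun3E (K : fieldType) (U1 U2 U3 U4 U5 : vectType K)
    (f : 'Hom(U4, U5)) (f3 : {linear U3 -> U4}) (f2 : {linear U2 -> U3})
    (f1 : {linear U1 -> U2}) u :
  (f \o linfun f3 \o linfun f2 \o linfun f1)%VF u = f (f3 (f2 (f1 u))).
Proof. by rewrite !comp_lfunE !lfunE. Qed.

Lemma lfunZ_sum (K : fieldType) (U V : vectType K) (f : 'Hom(U, V)) (a : K)
    (I : finType) (P : pred I) (u : I -> U) :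
  f (a *: \sum_(i | P i) u i) = a *: \sum_(i | P i) f (u i).
Proof. by rewrite linearZ linear_sum. Qed.

Section InducedLift.
Variables (K : fieldType) (n : nat) (H : {set 'S_n}).
Variables (V U : vectType K) (rho : 'S_n -> 'End(V)).
Variable phi : 'S_n -> 'Hom(V, U).
Local Notation M := (indmod H rho).

Lemma permcompA (f g h : 'S_n) : permcomp f (permcomp g h) = permcomp (permcomp f g) h.
Proof. by rewrite /permcomp mulgA. Qed.

Lemma tensE g v : tens H rho g v = qpi (indrel H rho) (ftens g v).
Proof. by rewrite comp_lfunE [linfun (ftens g) v]lfunE. Qed.

Lemma tens_rel (g h : 'S_n) (v : V) : h \in H ->
  tens H rho (permcomp g h) v = tens H rho g (rho h v).
Proof.
move=> hH; apply/eqP; rewrite -subr_eq0 /tens !comp_lfunE -linearB /=.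
rewrite qpi_eq0.
apply: (subvP (sumv_sup g isT (sumv_sup h hH (subvv _)))).
apply/memv_imgP; exists v; first exact: memvf.
by rewrite add_lfunE opp_lfunE comp_lfunE !lfunE.
Qed.

(** The universal property of induction. The coefficients [tcoef] depend on the chosen complement of
    the relations; [phi_rel] makes the resulting map independent of it. *)
Definition indlift : 'Hom(M, U) := \sum_(g : 'S_n) (phi g \o tcoef H rho g)%VF.

Hypothesis phi_rel : forall (g h : 'S_n) (v : V), h \in H ->
  phi (permcomp g h) v = phi g (rho h v).

Lemma indlift_tens g v : indlift (tens H rho g v) = phi g v.
Proof.
(* [L] is the same sum before passing to the quotient. It kills [indrel], so it does not see which
   representative [qrepr] picks. *)
pose L : 'Hom({ffun 'S_n -> V}, U) :=
  \sum_(g : 'S_n) (phi g \o linfun (@feval_fun K n V g))%VF.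
have Lf g' v' : L (ftens g' v') = phi g' v'.
  have E k : (phi k \o linfun (@feval_fun K n V k))%VF (ftens g' v') =
      if k == g' then phi k v' else 0.
    by rewrite comp_lfunE lfunE /= /feval_fun ffunE; case: eqP; rewrite ?linear0.
  rewrite /L sum_lfunE (bigD1 g') // E eqxx big1 => [|k /negPf kg].
    exact: addr0.
  by rewrite E kg.
have L0 : (indrel H rho <= lker L)%VS.
  apply/subv_sumP => g' _; apply/subv_sumP => h hH; apply/subvP => z.
  case/memv_imgP => v' _ ->; rewrite memv_ker add_lfunE opp_lfunE comp_lfunE !lfunE /=.
  by rewrite linearB /= !Lf phi_rel // subrr.
have -> : indlift (tens H rho g v) = L (qrepr _ (tens H rho g v)).
  rewrite /indlift /L !sum_lfunE; apply: eq_bigr => k _.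
  by rewrite !comp_lfunE.
rewrite -Lf; apply/eqP; rewrite -subr_eq0 -(linearB L) /= -memv_ker.
by apply: (subvP L0); rewrite tensE qrepr_qpi.
Qed.

End InducedLift.

(** * Transfer maps between the modules of two states *)

Section Transfer.
Variables (C : numClosedFieldType) (n m : nat) (G : multigraph n m).
Implicit Types (F : {set 'I_m}) (g h s : 'S_n).
Local Notation rV := 'rV[C]_n.
Local Notation Mmod := (Mmod C G).
Local Notation Mtens := (Mtens C G).
Local Notation Wstate := (Wstate C G).
Local Notation extstate := (extstate C G).
Local Notation extact := (extact C G).
Local Notation conn F := (connect (adj G F)).

Lemma conn_sym F : connect_sym (adj G F).
Proof.
apply: sym_connect_sym => u v; apply: eq_existsb => e.
by rewrite /joins orbC.
Qed.

Lemma componentsP F (B : {set 'I_n}) :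
  reflect (exists v, B = [set u | conn F v u]) (B \in components G F).
Proof.
apply: (iffP imsetP) => [[v _ ->] | [v ->]]; exists v => //.
  by apply/setP => u; rewrite !inE.
by apply/setP => u; rewrite !inE.
Qed.

(** A permutation that moves each vertex within its component maps the component into itself, and by
    cardinality onto itself. In this pointwise form the Young subgroup is visibly monotone along
    [refines]. *)
Lemma mem_youngS F g : (g \in youngS G F) = [forall v, conn F v (g v)].
Proof.
rewrite inE; apply/forall_inP/forallP => [gB v | gv B /componentsP[v ->]].
  have /gB/eqP gv : [set u | conn F v u] \in components G F.
    by apply/componentsP; exists v.
  have : g v \in [set u | conn F v u].
    by rewrite -gv imset_f // inE connect0.
  by rewrite inE.
rewrite eqEcard card_imset ?leqnn ?andbT; last exact: perm_inj.
apply/subsetP => _ /imsetP[u + ->]; rewrite !inE => vu.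
exact: connect_trans vu (gv u).
Qed.

Fact youngS_group_set F : group_set (youngS G F).
Proof.
apply/group_setP; split=> [|g h]; rewrite !mem_youngS.
  by apply/forallP => v; rewrite perm1 connect0.
move=> /forallP gv /forallP hv; apply/forallP => v; rewrite permM.
exact: connect_trans (gv v) (hv _).
Qed.
Canonical youngS_group F := Group (youngS_group_set F).

(** Components are compared instead of edge sets because a state [F] containing the triangle and
    [F :\ e3] refine each other. *)
Definition refines F F' := forall u v, conn F u v -> conn F' u v.

Lemma refines_subset F F' : F \subset F' -> refines F F'.
Proof.
move=> FF'; apply: connect_sub => u v /existsP[e /andP[eF uv]].
by apply: connect1; apply/existsP; exists e; rewrite uv (subsetP FF').
Qed.

Lemma youngS_mono F F' : refines F F' -> youngS G F \subset youngS G F'.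
Proof.
move=> r; apply/subsetP => g; rewrite !mem_youngS => /forallP gv.
by apply/forallP => v; apply: r.
Qed.

Lemma Wstate_permv F g x : g \in youngS G F -> x \in Wstate F ->
  permv g x \in Wstate F.
Proof.
move=> gF /memv_sumP[y yB ->]; rewrite linear_sum; apply: memv_sumr => B BF.
move/mem_Wset: (yB _ BF) => [y0 ys].
move: gF; rewrite inE => /forall_inP/(_ B BF)/eqP gB.
have mB v : (g^-1%g v \in B) = (v \in B).
  by rewrite -{2}gB -{2}(permKV g v) mem_imset //; apply: perm_inj.
apply/mem_Wset; split=> [v vB | ]; first by rewrite mxE y0 // mB.
rewrite -[RHS]ys [RHS](reindex_inj (@perm_inj _ g^-1)).
by apply: eq_big => v; rewrite ?mB // mxE.
Qed.

Lemma Wstate_mono F F' : refines F F' -> (Wstate F <= Wstate F')%VS.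
Proof.
move=> r; apply/subv_sumP => B /componentsP[v ->]; apply/subvP => x /mem_Wset[x0 xs].
have vF' : [set u | conn F' v u] \in components G F'.
  by apply/componentsP; exists v.
apply: (subvP (sumv_sup _ vF' (subvv _))); apply/mem_Wset.
have sub : [set u | conn F v u] \subset [set u | conn F' v u].
  by apply/subsetP => u; rewrite !inE; apply: r.
split=> [u uF' | ]; first by apply: x0; apply: contra uF'; apply/(subsetP sub).
rewrite (big_setID [set u | conn F v u]) /= (setIidPr sub) xs add0r.
by apply: big1 => u; rewrite inE => /andP[/x0].
Qed.

Lemma extstate_permv F g x : g \in youngS G F -> x \in extstate F ->
  extmap (permv g) x \in extstate F.
Proof. by move=> gF; apply: ext_map => v; apply: Wstate_permv. Qed.

Lemma extmap_permvM g h (x : extalg C n) :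
  extmap (permv (permcomp g h)) x = extmap (permv g) (extmap (permv h) x).
Proof. by rewrite extmap_comp; apply: eq_extmap => v; rewrite /= permvM. Qed.

Lemma MtensE F g x :
  Mtens F g x = tens (youngS G F) (extact F) g (vsproj (extstate F) x).
Proof. by rewrite /Mtens (comp_lfunE (tens _ _ _)) [linfun (vsproj _) x]lfunE. Qed.

Opaque Defs.Mtens.

Lemma extactE F g v :
  extact F g v = vsproj (extstate F) (extmap (permv g) (vsval v)).
Proof. by rewrite [LHS]lfunE. Qed.

Lemma Mtens_rel F g h x : h \in youngS G F -> x \in extstate F ->
  Mtens F (permcomp g h) x = Mtens F g (extmap (permv h) x).
Proof.
by move=> hF xF; rewrite !MtensE tens_rel // extactE vsprojK.
Qed.

Lemma Mtens_span F (y : Mmod F) :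
  exists2 x : 'S_n -> extalg C n, (forall g, x g \in extstate F) &
    y = \sum_g Mtens F g (x g).
Proof.
exists (fun g => vsval (tcoef (youngS G F) (extact F) g y)) => [g|].
  exact: subvsP.
rewrite {1}[y]tens_tcoef; apply: eq_bigr => g _.
by rewrite MtensE vsvalK.
Qed.

Lemma Mmod_ext F (U : vectType C) (f f' : 'Hom(Mmod F, U)) :
  (forall g x, x \in extstate F -> f (Mtens F g x) = f' (Mtens F g x)) ->
  f =1 f'.
Proof.
move=> ff' y; have [x xF ->] := Mtens_span y.
rewrite !linear_sum; apply: eq_bigr => g _; exact: ff'.
Qed.

(* The per-edge map F -> F - e sums over cosets; here the sum runs over the whole
   group S_F and is divided by the order of S_F'.  No choice of representatives
   is needed then, and the map makes sense for any pair of states, in particular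
   from F - e back to F. *)
Definition transfer_term F F' g : 'Hom(subvs_of (extstate F), Mmod F') :=
  \sum_(h in youngS G F)
    (Mtens F' (permcomp g h)
      \o linfun (extmap (orthproj (Wstate F')))
      \o linfun (extmap (permv h^-1%g))
      \o linfun (@vsval _ _ (extstate F)))%VF.

Definition transfer F F' : 'Hom(Mmod F, Mmod F') :=
  #|youngS G F'|%:R^-1 *:
  indlift (youngS G F) (extact F) (transfer_term F F').

Lemma transfer_termE F F' g v :
  transfer_term F F' g v =
  \sum_(h in youngS G F) Mtens F' (permcomp g h)
    (extmap (orthproj (Wstate F')) (extmap (permv h^-1%g) (vsval v))).
Proof.
by rewrite /transfer_term sum_lfunE; apply: eq_bigr => h _; apply: comp_linfun3E.
Qed.

(** Summing over all of S_F absorbs [h]: the index [f] is replaced by [h] composed with [f], and the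
    inverse of this composite cancels the [h] acting on [v]. *)
Lemma transfer_term_rel F F' g h v : h \in youngS G F ->
  transfer_term F F' (permcomp g h) v = transfer_term F F' g (extact F h v).
Proof.
move=> hF; rewrite !transfer_termE [RHS](reindex_inj (mulIg h)) /=.
under [RHS]eq_bigl => f do rewrite groupMr //.
apply: eq_bigr => f fF; rewrite -permcompA; congr (fun_of_lfun _ (extmap _ _)).
rewrite extactE vsprojK; last by apply: extstate_permv => //; apply: subvsP.
by rewrite -extmap_permvM /permcomp invMg mulgA mulgV mul1g.
Qed.

Lemma transfer_Mtens F F' g x : x \in extstate F ->
  transfer F F' (Mtens F g x) =
  #|youngS G F'|%:R^-1 *: \sum_(h in youngS G F)
    Mtens F' (permcomp g h)
      (extmap (orthproj (Wstate F')) (extmap (permv h^-1%g) x)).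
Proof.
move=> xF; apply: etrans (scale_lfunE _ _ _) _; apply: congr1.
apply: etrans (congr1 (fun_of_lfun (indlift _ _ _)) (MtensE _ _ _)) _.
apply: etrans (indlift_tens _ _ _) _.
  by move=> k h v; apply: transfer_term_rel.
by rewrite transfer_termE vsprojK.
Qed.

Lemma extmap_proj_mem F (x : extalg C n) (W : {vspace rV}) : x \in ext W ->
  extmap (orthproj (Wstate F)) x \in extstate F.
Proof. by apply: ext_map => v _; apply: orthproj_mem. Qed.

Lemma youngS_card F : #|youngS G F|%:R != 0 :> C.
Proof. by rewrite pnatr_eq0 -lt0n cardG_gt0. Qed.

Lemma orthproj_young F g x : g \in youngS G F ->
  orthproj (Wstate F) (permv g x) = permv g (orthproj (Wstate F) x).
Proof.
by move=> gF; apply: orthproj_permv => y yF; apply: Wstate_permv; rewrite ?groupV.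
Qed.

(** The composite is a double sum over [k] in S_F' and [h] in S_F. Since [k] also lies in S_F,
    substituting [h] composed with [k] shows that the sum over [h] does not depend on [k], and the
    |S_F'| equal copies cancel the normalisation of the first map. On vectors, [k^-1] commutes with
    the projection to W_F', which the further projection to W_F'' absorbs. *)
Lemma transfer_comp F F' F'' : refines F'' F' -> refines F' F ->
  forall y, transfer F' F'' (transfer F F' y) = transfer F F'' y.
Proof.
move=> r'' r' y; apply: etrans (esym (comp_lfunE _ _ _)) _.
apply: (Mmod_ext (f := (transfer F' F'' \o transfer F F')%VF)) => g x xF.
apply: etrans (comp_lfunE _ _ _) _.
apply: etrans (congr1 (fun_of_lfun (transfer F' F'')) (transfer_Mtens F' g xF)) _.
apply: etrans _ (esym (transfer_Mtens F'' g xF)).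
rewrite linearZ.
rewrite linear_sum.
rewrite /=.
have xh h : h \in youngS G F ->
    extmap (orthproj (Wstate F')) (extmap (permv h^-1%g) x) \in extstate F'.
  by move=> hF; apply: extmap_proj_mem; apply: extstate_permv xF; rewrite groupV.
rewrite (eq_bigr _ (fun h hF => transfer_Mtens F'' (permcomp g h) (xh h hF))).
rewrite -scaler_sumr scalerA mulrC -scalerA; apply: congr1.
have E k : k \in youngS G F' ->
    \sum_(h in youngS G F) Mtens F'' (permcomp (permcomp g h) k)
       (extmap (orthproj (Wstate F'')) (extmap (permv k^-1%g)
         (extmap (orthproj (Wstate F')) (extmap (permv h^-1%g) x)))) =
    \sum_(h in youngS G F) Mtens F'' (permcomp g h)
       (extmap (orthproj (Wstate F'')) (extmap (permv h^-1%g) x)).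
  move=> kF'; have kF : k \in youngS G F by apply: (subsetP (youngS_mono r')).
  rewrite [RHS](reindex_inj (mulgI k)) /=.
  under [RHS]eq_bigl => f do rewrite groupMl //.
  apply: eq_bigr => h hF; rewrite permcompA; congr (Mtens _ _ _).
  rewrite !extmap_comp; apply: eq_extmap => v /=.
  rewrite -orthproj_young ?groupV // orthproj_comp; last exact: Wstate_mono.
  by rewrite -permvM /permcomp invMg.
rewrite exchange_big /= (eq_bigr _ E) sumr_const -scaler_nat scalerA mulVf.
  by rewrite scale1r.
exact: youngS_card.
Qed.

(** The projection fixes W_F, so each of the |S_F| terms is (g o h) (x) h^-1 x = g (x) x. *)
Lemma transfer_id F y : transfer F F y = y.
Proof.
rewrite -[RHS]id_lfunE; move: y; apply: Mmod_ext => g x xF.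
rewrite transfer_Mtens // id_lfunE (eq_bigr (fun=> Mtens F g x)) => [|h hF].
  by rewrite sumr_const -scaler_nat scalerA mulVf ?scale1r ?youngS_card.
have hxF : extmap (permv h^-1%g) x \in extstate F.
  by apply: extstate_permv; rewrite ?groupV.
rewrite (ext_map_id (W := Wstate F)) // => [|v vF]; last exact: orthproj_id.
rewrite Mtens_rel // -extmap_permvM /permcomp mulVg.
by rewrite (ext_map_id (W := Wstate F)) // => v _; rewrite /= permv1.
Qed.

Lemma Mdeg_ind F j (V : {vspace Mmod F}) :
  (forall g x, x \in extpow j (Wstate F) -> Mtens F g x \in V) ->
  (Mdeg C G F j <= V)%VS.
Proof.
move=> gx; apply/subv_sumP => g _; apply/subvP => _ /memv_imgP[x xj ->].
exact: gx.
Qed.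

Lemma Mtens_deg F j g x : x \in extpow j (Wstate F) -> Mtens F g x \in Mdeg C G F j.
Proof.
move=> xj; apply: (subvP (sumv_sup g isT (subvv _))); exact: memv_img.
Qed.

(** The bound [j <= n] puts [extpow j] inside [extstate F], whose defining sum stops at degree [n];
    [transfer_Mtens] is available only there. *)
Lemma transfer_deg F F' (j : 'I_n.+1) y :
  y \in Mdeg C G F j -> transfer F F' y \in Mdeg C G F' j.
Proof.
move=> yj; rewrite memv_preim; apply: subvP yj; apply: Mdeg_ind => g x xj.
rewrite -memv_preim.
have xF : x \in extstate F by apply: subvP xj; apply: extpow_ext.
have -> := transfer_Mtens F' g xF.
rewrite rpredZ // rpred_sum // => h hF; apply: Mtens_deg.
apply: (extpow_map (W := Wstate F)) => [v _|]; first exact: orthproj_mem.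
apply: extpow_map xj => v; apply: Wstate_permv; by rewrite groupV.
Qed.

(** The summand is constant on each coset k S_F', because an element of S_F' moves across the tensor
    sign and commutes with the projection to W_F'. Summing over S_F and dividing by |S_F'| thus
    leaves one term per coset, whichever representative [repr] picks. *)
Lemma dedgeE F e : dedge C G F e = transfer F (F :\ e).
Proof.
set F' := F :\ e.
have rF : refines F' F by apply: refines_subset; rewrite subsetDl.
have sF := youngS_mono rF.
apply/lfunP => y; apply: etrans _ (esym (scale_lfunE _ _ _)).
apply: etrans (sum_lfunE _ _ _ _) _.
apply: etrans _ (esym (congr1 _ (sum_lfunE _ _ _ _))); rewrite scaler_sumr.
apply: eq_bigr => g _; apply: etrans (sum_lfunE _ _ _ _) _.
apply: etrans _ (esym (congr1 _ (comp_lfunE _ _ _))).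
set z := tcoef _ _ g y; apply: etrans _ (esym (congr1 _ (transfer_termE _ _ _))).
pose t h : Mmod F' := Mtens F' (permcomp g h)
  (extmap (orthproj (Wstate F')) (extmap (permv h^-1%g) (vsval z))).
have tD k h : k \in youngS G F -> h \in youngS G F' -> t (h * k)%g = t k.
  move=> kF hF'; have hF := subsetP sF _ hF'.
  have zF : extmap (permv (h * k)^-1%g) (vsval z) \in extstate F.
    by apply: extstate_permv; rewrite ?groupV ?groupM //; apply: subvsP.
  rewrite /t [permcomp g _]permcompA Mtens_rel //; last exact: extmap_proj_mem zF.
  apply: congr1; rewrite !extmap_comp; apply: eq_extmap => v /=.
  rewrite -orthproj_young //; apply: congr1.
  by rewrite -permvM /permcomp invMg mulgKV.
have tDr k D : k \in youngS G F -> D = (youngS G F' :* k)%g ->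
    \sum_(h in D) t h = #|youngS G F'|%:R *: t (repr D).
  move=> kF ->; have /rcosetP[r rF' rE] := mem_repr_rcoset [group of youngS G F'] k.
  rewrite scaler_nat -(card_rcoset _ k) -sumr_const.
  apply: eq_bigr => _ /rcosetP[h hF' ->].
  by rewrite rE !tD.
have /and3P[/eqP cov triv _] := rcosets_partition sF.
have St : \sum_(h in youngS G F) t h =
    \sum_(D in rcosets (youngS G F') (youngS G F)) \sum_(h in D) t h.
  by rewrite -big_trivIset // cov.
transitivity (#|youngS G F'|%:R^-1 *: \sum_(h in youngS G F) t h); last by [].
rewrite St scaler_sumr; apply: eq_bigr => D /rcosetsP[k kF DE].
rewrite (tDr k D kF DE) scalerA mulVf ?youngS_card // scale1r.
by apply: etrans (comp_lfunE _ _ _) _; apply: comp_linfun3E.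
Qed.

Lemma indact_Mtens F s g x :
  indact (youngS G F) (extact F) s (Mtens F g x) = Mtens F (permcomp s g) x.
Proof.
apply: etrans (congr1 (fun_of_lfun (indact _ _ _)) (MtensE _ _ _)) _.
apply: etrans _ (esym (MtensE _ _ _)).
(* [indact] unfolds to the [indlift] of this family. *)
apply: (indlift_tens (phi := fun g => tens _ _ (permcomp s g))) => k h v hF.
by rewrite permcompA tens_rel.
Qed.

Lemma indact_deg F j s y :
  y \in Mdeg C G F j -> indact (youngS G F) (extact F) s y \in Mdeg C G F j.
Proof.
move=> yj; rewrite memv_preim; apply: subvP yj; apply: Mdeg_ind => g x xj.
by rewrite -memv_preim; have -> := indact_Mtens F s g x; apply: Mtens_deg.
Qed.

Lemma transfer_indact F F' s y :
  transfer F F' (indact (youngS G F) (extact F) s y) =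
  indact (youngS G F') (extact F') s (transfer F F' y).
Proof.
apply: etrans (esym (comp_lfunE _ _ _)) _; apply: etrans _ (comp_lfunE _ _ _).
apply: (Mmod_ext (f := (transfer F F' \o indact _ _ s)%VF)
  (f' := (indact _ _ s \o transfer F F')%VF)) => g x xF.
apply: etrans (comp_lfunE _ _ _) _; apply: etrans _ (esym (comp_lfunE _ _ _)).
apply: etrans (congr1 (fun_of_lfun (transfer F F')) (indact_Mtens _ _ _ _)) _.
apply: etrans (transfer_Mtens _ _ xF) _.
apply: etrans _ (esym (congr1 (fun_of_lfun (indact _ _ s)) (transfer_Mtens _ _ xF))).
apply: etrans _ (esym (lfunZ_sum _ _ _ _)); apply: congr1; apply: eq_bigr => h hF.
by apply: etrans _ (esym (indact_Mtens _ _ _ _)); rewrite permcompA.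
Qed.

End Transfer.

(** * Mayer-Vietoris sequence of a contractible triad *)

Section Subquotient.
Variables (K : fieldType) (V : vectType K) (Z Bd : {vspace V}).

(** The quotient of [Z] by its intersection with [Bd]. [Hdeg] unfolds to this for cycles and
    boundaries, so the abstract sequence applies to it by conversion. *)
Definition subquot : vectType K := quotv (linfun (@vsval _ _ Z) @^-1: Bd)%VS.
Definition sqclass : 'Hom(V, subquot) := (qpi _ \o linfun (vsproj Z))%VF.
Definition sqrepr : 'Hom(subquot, V) := (linfun (@vsval _ _ Z) \o qrepr _)%VF.

Lemma sqreprE y : sqrepr y = vsval (qrepr _ y).
Proof. by rewrite /sqrepr comp_lfunE [LHS]lfunE. Qed.

Lemma sqclassE z : sqclass z = qpi _ (vsproj Z z).
Proof. by rewrite /sqclass comp_lfunE [linfun _ z]lfunE. Qed.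

Lemma sqclass_eq0 z : z \in Z -> (sqclass z == 0) = (z \in Bd).
Proof. by move=> zZ; rewrite sqclassE qpi_eq0 -memv_preim lfunE /= vsprojK. Qed.

Lemma sqclass_eq z z' : z \in Z -> z' \in Z ->
  sqclass z = sqclass z' <-> z - z' \in Bd.
Proof.
move=> zZ z'Z; rewrite -sqclass_eq0 ?rpredB // linearB /= subr_eq0.
by split=> [->|/eqP].
Qed.

Lemma sqrepr_mem y : sqrepr y \in Z.
Proof. by rewrite sqreprE subvsP. Qed.

Lemma sqreprK y : sqclass (sqrepr y) = y.
Proof. by rewrite sqclassE sqreprE vsvalK qreprK. Qed.

Lemma sqreprB z : z \in Z -> sqrepr (sqclass z) - z \in Bd.
Proof.
by move=> zZ; apply/(sqclass_eq (sqrepr_mem _) zZ); rewrite sqreprK.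
Qed.

Lemma sqclass_onto y : exists2 z, z \in Z & y = sqclass z.
Proof. by exists (sqrepr y); rewrite ?sqrepr_mem ?sqreprK. Qed.

End Subquotient.

Lemma comp_zigzagE (K : fieldType) (U V W : vectType K) (q : 'Hom(V, W))
    (r : 'Hom(U, V)) (d p s : 'End(V)) u :
  (q \o d \o p \o (\1 - (d \o s)) \o r)%VF u =
  q (d (p (r u - d (s (r u))))).
Proof.
by rewrite !comp_lfunE add_lfunE opp_lfunE comp_lfunE id_lfunE.
Qed.

Section MayerVietoris.
Variables (K : fieldType) (V : vectType K) (d : 'End(V)).
Variables (E A B D : nat -> {vspace V}) (S : V -> Prop) (s p : 'End(V)).

Implicit Types (X Y : nat -> {vspace V}) (x z : V) (i : nat).

Definition cyc (X : nat -> {vspace V}) i := (X i :&: lker d)%VS.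
Definition bnd (X : nat -> {vspace V}) i := (d @: X i.+1)%VS.
Definition Hmod X i : vectType K := subquot (cyc X i) (bnd X i).
Definition cl X i : 'Hom(V, Hmod X i) := sqclass (cyc X i) (bnd X i).
Definition rep X i : 'Hom(Hmod X i, V) := sqrepr (cyc X i) (bnd X i).

(* E is the total complex, A and B two subcomplexes with intersection D.  The
   predicate S describes membership in A + B, p is a projection of A + B to A,
   and S_contract says that s contracts the quotient of E by A + B. *)
Record triad : Prop := Triad {
  triad_dd : forall x, d (d x) = 0;
  triad_dE : forall i x, x \in E i.+1 -> d x \in E i;
  triad_dA : forall i x, x \in A i.+1 -> d x \in A i;
  triad_dB : forall i x, x \in B i.+1 -> d x \in B i;
  triad_d0 : forall x, x \in E 0 -> d x = 0;
  triad_memD : forall i x, (x \in D i) = (x \in A i) && (x \in B i);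
  triad_AE : forall i, (A i <= E i)%VS;
  triad_BE : forall i, (B i <= E i)%VS;
  triad_S_AB : forall i x y, x \in A i -> y \in B i -> S (x + y);
  triad_S_split : forall i x, x \in E i -> S x -> p x \in A i /\ x - p x \in B i;
  triad_sE : forall i x, x \in E i -> s x \in E i.+1;
  triad_S_contract : forall x, S (d x) -> S (x - d (s x)) }.

Hypothesis tr : triad.
Let dd := triad_dd tr.
Let dE := triad_dE tr.
Let dA := triad_dA tr.
Let dB := triad_dB tr.
Let d0 := triad_d0 tr.
Let memD := triad_memD tr.
Let AE := triad_AE tr.
Let BE := triad_BE tr.
Let S_AB := triad_S_AB tr.
Let S_split := triad_S_split tr.
Let sE := triad_sE tr.
Let S_contract := triad_S_contract tr.

Lemma mem_cyc (X : nat -> {vspace V}) i x : (x \in cyc X i) = (x \in X i) && (d x == 0).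
Proof. by rewrite memv_cap memv_ker. Qed.

Lemma bndP X i x : reflect (exists2 y, y \in X i.+1 & x = d y) (x \in bnd X i).
Proof. exact: memv_imgP. Qed.

Lemma S0 : S 0.
Proof. by rewrite -[0]addr0; apply: (@S_AB 0); apply: mem0v. Qed.

Definition incl X Y i : 'Hom(Hmod X i, Hmod Y i) := (cl Y i \o rep X i)%VF.

Lemma incl_cl X Y i z : (forall k, (X k <= Y k)%VS) -> z \in cyc X i ->
  incl X Y i (cl X i z) = cl Y i z.
Proof.
move=> XY zX; rewrite /incl comp_lfunE; have sXY : (cyc X i <= cyc Y i)%VS.
  exact: capvS (XY _) (subvv _).
apply/sqclass_eq; [exact: subvP sXY _ (sqrepr_mem _)|exact: subvP sXY _ zX|].
exact: subvP (limgS _ (XY _)) _ (sqreprB _ zX).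
Qed.

Lemma contract_split i x : x \in E i -> S (d x) ->
  exists a b, [/\ a \in A i, b \in B i & x - d (s x) = a + b].
Proof.
move=> xE /S_contract Sx.
have [pA pB] := S_split (rpredB xE (dE (sE xE))) Sx.
exists (p (x - d (s x))), (x - d (s x) - p (x - d (s x))).
split=> //; by rewrite [RHS]addrC subrK.
Qed.

(** The usual zigzag: [\1 - (d \o s)] replaces a cycle of [E] by a homologous one in [A + B], [p]
    takes its part in [A], and the boundary of that part lies in [D]. *)
Definition connecting i : 'Hom(Hmod E i.+1, Hmod D i) :=
  (cl D i \o d \o p \o (\1 - (d \o s)) \o rep E i.+1)%VF.

Lemma DA i : (D i <= A i)%VS.
Proof. by apply/subvP => x; rewrite memD => /andP[]. Qed.

Lemma DB i : (D i <= B i)%VS.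
Proof. by apply/subvP => x; rewrite memD => /andP[]. Qed.

(** This is injectivity of the homology of [A + B] into that of [E]: the contraction turns a chain
    of [E] bounded by [a + b] into one in [A + B]. Then [a - d a' = d b' - b] lies in both
    subcomplexes. *)
Lemma split_boundary i a b x : a \in A i -> b \in B i -> x \in E i.+1 ->
  a + b = d x -> exists a' b', [/\ a' \in A i.+1, b' \in B i.+1,
    a + b = d a' + d b' & a - d a' \in D i].
Proof.
move=> aA bB xE abx; have Sx : S (d x) by rewrite -abx; apply: S_AB aA bB.
have [a' [b' [a'A b'B e]]] := contract_split xE Sx.
have ab : a + b = d a' + d b' by rewrite -linearD -e linearB /= dd subr0.
exists a', b'; split=> //; rewrite memD rpredB ?dA //=.
have -> : a - d a' = d b' - b.
  by apply/eqP; rewrite subr_eq addrAC [_ + d a']addrC -ab addrK.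
by rewrite rpredB ?dB.
Qed.

(** The zigzag may use any decomposition of any cycle homologous to [z], not just the one made by
    [s] and [p]. The difference of two decompositions is a boundary, so [split_boundary] corrects
    the difference of the [A]-parts by a boundary to a chain of [D], whose differential is the
    difference of the two results. *)
Lemma connecting_cl i z y a b : z \in cyc E i.+1 -> y \in E i.+2 ->
  a \in A i.+1 -> b \in B i.+1 -> z - d y = a + b ->
  d a \in cyc D i /\ connecting i (cl E i.+1 z) = cl D i (d a).
Proof.
have daD z' y' a' b' : z' \in cyc E i.+1 -> a' \in A i.+1 -> b' \in B i.+1 ->
    z' - d y' = a' + b' -> d a' \in cyc D i.
  rewrite mem_cyc => /andP[_ /eqP dz] aA bB e; rewrite mem_cyc dd eqxx andbT memD dA //=.
  have : d (z' - d y') = d a' + d b' by rewrite e linearD.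
  rewrite linearB /= dz dd subr0 => /esym/eqP; rewrite addr_eq0 => /eqP ->.
  by rewrite rpredN dB.
move=> zE yE aA bB e; split; first exact: daD e.
rewrite /connecting comp_zigzagE.
set z0 := rep E i.+1 _.
have z0Z : z0 \in cyc E i.+1 := sqrepr_mem _.
have /bndP[x xE z0z] := sqreprB (bnd E i.+1) zE; rewrite -/z0 in z0z.
have z0E : z0 \in E i.+1 by move: z0Z; rewrite mem_cyc => /andP[].
have Sz0 : S (z0 - d (s z0)).
  by apply: S_contract; move: z0Z; rewrite mem_cyc => /andP[_ /eqP ->]; apply: S0.
have [a0A b0B] := S_split (rpredB z0E (dE (sE z0E))) Sz0.
set a0 := p _ in a0A b0B *; set b0 := _ - a0 in b0B.
have e0 : z0 - d (s z0) = a0 + b0 by rewrite [RHS]addrC subrK.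
apply/sqclass_eq; [exact: daD e0|exact: daD e|].
(* With [z0 - z = d x], the decomposed cycles [z0 - d (s z0)] and [z - d y] differ by the boundary
   of [x - s z0 + y]. *)
have eX : (a0 - a) + (b0 - b) = d (x - s z0 + y).
  have -> : d (x - s z0 + y) = z0 - z - d (s z0) + d y.
    by rewrite linearD /= (linearB d) /= -z0z.
  by rewrite addrACA -opprD -e0 -e opprD opprK addrACA addrA.
have XE : x - s z0 + y \in E i.+2 by rewrite rpredD ?rpredB ?sE.
have [a' [b' [a'A b'B _ aD]]] := split_boundary (rpredB a0A aA) (rpredB b0B bB) XE eX.
apply/bndP; exists (a0 - a - d a') => //.
by rewrite !linearB /= dd subr0.
Qed.

Lemma cl_surj X i (y : Hmod X i) : exists2 z, z \in cyc X i & y = cl X i z.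
Proof. exact: sqclass_onto. Qed.

Lemma cl_eq0 X i z : z \in cyc X i -> cl X i z = 0 <-> z \in bnd X i.
Proof.
by move=> zZ; rewrite -(sqclass_eq0 (bnd X i) zZ); split=> [->|/eqP].
Qed.

Lemma cl_eq X i z z' : z \in cyc X i -> z' \in cyc X i -> z - z' \in bnd X i ->
  cl X i z = cl X i z'.
Proof. by move=> zZ zZ' b; apply/sqclass_eq. Qed.

Lemma cycS X Y i z : (forall k, (X k <= Y k)%VS) -> z \in cyc X i -> z \in cyc Y i.
Proof. by move=> XY; apply: subvP; exact: capvS (XY _) (subvv _). Qed.

Lemma MV_exact_middle i (a : Hmod A i) (b : Hmod B i) :
  incl A E i a + incl B E i b = 0 <->
  exists y, a = incl D A i y /\ b = - incl D B i y.
Proof.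
split=> [|[y [-> ->]]]; last first.
  have [z zZ ->] := cl_surj y; have [zA zB] := (cycS DA zZ, cycS DB zZ).
  by rewrite !incl_cl // ?linearN /= ?incl_cl ?subrr //; [exact: DB|exact: DA].
have [x xZ ->] := cl_surj a; have [y yZ ->] := cl_surj b.
rewrite !incl_cl // -linearD => /cl_eq0 xy0.
have /bndP[w wE xyE] := xy0 (rpredD (cycS AE xZ) (cycS BE yZ)).
move: (xZ) (yZ); rewrite !mem_cyc => /andP[xA /eqP dx] /andP[yB /eqP dy].
have [a' [b' [a'A b'B e zD]]] := split_boundary xA yB wE xyE.
(* This cycle of [D] is homologous to [x] in [A], and its negative to [y] in [B], because
   [y + (x - d a') = d b']. *)
have zZ : x - d a' \in cyc D i by rewrite mem_cyc zD linearB /= dx dd subr0 eqxx.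
exists (cl D i (x - d a')); rewrite !incl_cl //; try exact: DA; try exact: DB.
split.
  apply: cl_eq (cycS DA zZ) _ => //.
  by rewrite opprB addrC subrK; apply/bndP; exists a'.
rewrite -linearN; apply: cl_eq; rewrite ?rpredN ?(cycS DB zZ) //.
rewrite opprK addrA [y + x]addrC e addrAC subrr add0r.
by apply/bndP; exists b'.
Qed.

Lemma MV_exact_E i (y : Hmod E i.+1) :
  connecting i y = 0 <-> exists a b, y = incl A E i.+1 a + incl B E i.+1 b.
Proof.
have [z zZ ->] := cl_surj y; split=> [|[a0 [b0]]].
  move: (zZ); rewrite mem_cyc => /andP[zE /eqP dz].
  have Sz : S (d z) by rewrite dz; apply: S0.
  have [a [b [aA bB e]]] := contract_split zE Sz.
  have [daZ ->] := connecting_cl zZ (sE zE) aA bB e.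
  move=> /(cl_eq0 daZ)/bndP[w wD daw].
  (* Since [d a = d w], moving [w] from [a] over to [b] makes both parts cycles and keeps their
     sum. *)
  have [wA wB] : w \in A i.+1 /\ w \in B i.+1 by apply/andP; rewrite -memD.
  have awZ : a - w \in cyc A i.+1.
    by rewrite mem_cyc rpredB //= linearB /= daw subrr.
  have bwZ : b + w \in cyc B i.+1.
    rewrite mem_cyc rpredD //= linearD /= -daw addrC -linearD -e.
    by rewrite linearB /= dd dz subr0.
  exists (cl A i.+1 (a - w)), (cl B i.+1 (b + w)); rewrite !incl_cl // -linearD.
  apply: cl_eq => //; first by rewrite rpredD ?(cycS AE awZ) ?(cycS BE bwZ).
  rewrite addrACA [_ + w]addrC subrr addr0 -e opprB addrC subrK.
  by apply/bndP; exists (s z); rewrite ?sE.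
have [a aZ ->] := cl_surj a0; have [b bZ ->] := cl_surj b0.
rewrite !incl_cl // -linearD => ->.
move: (aZ) (bZ); rewrite !mem_cyc => /andP[aA /eqP da] /andP[bB _].
have abZ : a + b \in cyc E i.+1 by rewrite rpredD ?(cycS AE aZ) ?(cycS BE bZ).
have [|_ ->] := connecting_cl abZ (mem0v _) aA bB _; first by rewrite linear0 subr0.
by rewrite da linear0.
Qed.

Lemma MV_exact_D i (y : Hmod D i) :
  (incl D A i y = 0 /\ incl D B i y = 0) <-> exists w, y = connecting i w.
Proof.
split=> [|[w ->]].
  have [z zZ ->] := cl_surj y; rewrite !incl_cl //; try exact: DA; try exact: DB.
  case=> /(cl_eq0 (cycS DA zZ))/bndP[a aA za] /(cl_eq0 (cycS DB zZ))/bndP[b bB zb].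
  (* As [z = d a = d b], the chain [a - b] is a cycle that comes already decomposed, and the zigzag
     sends it to the class of [d a = z]. *)
  have abZ : a - b \in cyc E i.+1.
    rewrite mem_cyc linearB /= -za -zb subrr eqxx andbT.
    by rewrite rpredB ?(subvP (AE _) _ aA) ?(subvP (BE _) _ bB).
  exists (cl E i.+1 (a - b)).
  have bB' : - b \in B i.+1 by rewrite rpredN.
  have [|_ ->] := connecting_cl abZ (mem0v _) aA bB' _; last by rewrite za.
  by rewrite linear0 subr0.
have [z zZ ->] := cl_surj w; move: (zZ); rewrite mem_cyc => /andP[zE /eqP dz].
have Sz : S (d z) by rewrite dz; apply: S0.
have [a [b [aA bB e]]] := contract_split zE Sz.
have [daZ ->] := connecting_cl zZ (sE zE) aA bB e.
rewrite !incl_cl //; try exact: DA; try exact: DB.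
split; first by apply/(cl_eq0 (cycS DA daZ)); apply/bndP; exists a.
apply/(cl_eq0 (cycS DB daZ)); apply/bndP; exists (- b); first by rewrite rpredN.
apply/eqP; rewrite linearN -addr_eq0 -linearD -e.
by rewrite linearB /= dd dz subr0.
Qed.

(** In degree 0 every chain is a cycle, so the two parts of the decomposition are cycles on their
    own. *)
Lemma MV_surj0 (y : Hmod E 0) : exists a b, y = incl A E 0 a + incl B E 0 b.
Proof.
have [z zZ ->] := cl_surj y; move: (zZ); rewrite mem_cyc => /andP[zE /eqP dz].
have Sz : S (d z) by rewrite dz; apply: S0.
have [a [b [aA bB e]]] := contract_split zE Sz.
have aZ : a \in cyc A 0 by rewrite mem_cyc aA d0 ?eqxx // (subvP (AE _)).
have bZ : b \in cyc B 0 by rewrite mem_cyc bB d0 ?eqxx // (subvP (BE _)).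
exists (cl A 0 a), (cl B 0 b); rewrite !incl_cl // -linearD.
apply: cl_eq => //; first by rewrite rpredD ?(cycS AE aZ) ?(cycS BE bZ).
rewrite -e opprB addrC subrK; by apply/bndP; exists (s z); rewrite ?sE.
Qed.

Section Equivariance.
Variable c : 'End(V).
Hypothesis dc : forall x, d (c x) = c (d x).
Hypothesis cA : forall i x, x \in A i -> c x \in A i.
Hypothesis cB : forall i x, x \in B i -> c x \in B i.
Hypothesis cE : forall i x, x \in E i -> c x \in E i.

Definition hact X i (y : Hmod X i) : Hmod X i := cl X i (c (rep X i y)).

Lemma hactD X i (y z : Hmod X i) : hact (y + z) = hact y + hact z.
Proof. by rewrite /hact !linearD. Qed.

Lemma hactN X i (y : Hmod X i) : hact (- y) = - hact y.
Proof. by rewrite /hact !linearN. Qed.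

Lemma cyc_act X i z : (forall k x, x \in X k -> c x \in X k) ->
  z \in cyc X i -> c z \in cyc X i.
Proof.
by move=> cX; rewrite !mem_cyc dc => /andP[/cX -> /eqP ->]; rewrite linear0 eqxx.
Qed.

Lemma hact_cl X i z : (forall k x, x \in X k -> c x \in X k) ->
  z \in cyc X i -> hact (cl X i z) = cl X i (c z).
Proof.
move=> cX zZ; apply: cl_eq; rewrite ?cyc_act //; first exact: sqrepr_mem.
have /bndP[w wX e] := sqreprB (bnd X i) zZ; rewrite -linearB /= e -dc.
by apply/bndP; exists (c w); rewrite ?cX.
Qed.

Lemma incl_hact X Y i y : (forall k x, x \in X k -> c x \in X k) ->
  (forall k x, x \in Y k -> c x \in Y k) -> (forall k, (X k <= Y k)%VS) ->
  incl X Y i (hact y) = hact (incl X Y i y).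
Proof.
move=> cX cY XY; have [z zZ ->] := cl_surj y.
by rewrite hact_cl // !incl_cl ?hact_cl ?cyc_act ?(cycS XY zZ).
Qed.

(** Commutation of [c] with [s] and [p] is not at hand; instead [connecting_cl] allows [c z] to be
    decomposed by applying [c] to the decomposition of [z]. *)
Lemma connecting_hact i y : connecting i (hact y) = hact (connecting i y).
Proof.
have cD k x : x \in D k -> c x \in D k by rewrite !memD => /andP[/cA -> /cB ->].
have [z zZ ->] := cl_surj y; move: (zZ); rewrite mem_cyc => /andP[zE /eqP dz].
have Sz : S (d z) by rewrite dz; apply: S0.
have [a [b [aA bB e]]] := contract_split zE Sz.
have [daZ ->] := connecting_cl zZ (sE zE) aA bB e; rewrite !hact_cl //.
have czZ := cyc_act cE zZ.
have [|_ ->] := connecting_cl czZ (cE (sE zE)) (cA aA) (cB bB) _.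
  by rewrite dc -linearB /= e linearD.
by rewrite dc.
Qed.

End Equivariance.
End MayerVietoris.

(** * Coordinates in direct sums *)

Section DirectSumLemmas.
Variables (K : fieldType) (I : finType) (T : I -> vectType K).

Lemma dprojE i (x : dsum T) : dproj T i x = x i.
Proof. exact: lfunE. Qed.

Lemma dinj_in i (y : T i) : dinj T i y i = y.
Proof. by rewrite lfunE /= ffunE dfwith_in. Qed.

Lemma dinj_out i j (y : T i) : i != j -> dinj T i y j = 0.
Proof. by move=> ij; rewrite lfunE /= ffunE dfwith_out. Qed.

Lemma dsumP (x y : dsum T) : (forall i, x i = y i) -> x = y.
Proof. by move=> xy; apply/ffunP. Qed.

Lemma dsumDE (x y : dsum T) i : (x + y) i = x i + y i.
Proof. by rewrite ffunE. Qed.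

Lemma dsumBE (x y : dsum T) i : (x - y) i = x i - y i.
Proof. by rewrite !ffunE. Qed.

Lemma dsum0E i : (0 : dsum T) i = 0.
Proof. by rewrite ffunE. Qed.

Lemma dsum_sumE (J : Type) (r : seq J) (P : pred J) (F : J -> dsum T) i :
  (\sum_(j <- r | P j) F j) i = \sum_(j <- r | P j) F j i.
Proof.
have -> : (\sum_(j <- r | P j) F j) i = dproj T i (\sum_(j <- r | P j) F j).
  by rewrite dprojE.
by rewrite linear_sum; apply: eq_bigr => j _; exact: dprojE.
Qed.

Lemma dsumZE a (x : dsum T) i : (a *: x) i = a *: x i.
Proof. by rewrite ffunE. Qed.

Lemma dsum_dinj (x : dsum T) : x = \sum_i dinj T i (x i).
Proof.
apply: dsumP => i; rewrite dsum_sumE (bigD1 i) //= dinj_in big1 ?addr0 // => j ji.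
exact: dinj_out.
Qed.

End DirectSumLemmas.

(** * The complex of states *)

Section StateComplex.
Variables (K : numFieldType) (m : nat) (M : {set 'I_m} -> vectType K).
Variables (T : forall F F', 'Hom(M F, M F')) (dg : forall F, {vspace M F}).
Implicit Types (F A : {set 'I_m}) (e : 'I_m) (x : dsum M).

Definition sgn F e : K := (-1) ^+ #|[set f in F | (e < f)%N]|.

Definition sdiff : 'End(dsum M) :=
  \sum_(F : {set 'I_m}) \sum_(e in F)
    sgn F e *: (dinj M (F :\ e) \o T F (F :\ e) \o dproj M F)%VF.

Definition schain A i : {vspace dsum M} :=
  (\sum_(F : {set 'I_m} | (F \subset A) && (#|F| == i)) dinj M F @: dg F)%VS.

Lemma mem_schain A i x : reflect
  (forall F, x F \in (if (F \subset A) && (#|F| == i) then dg F else 0%VS))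
  (x \in schain A i).
Proof.
apply: (iffP idP) => [xA F | xA].
  rewrite -dprojE memv_preim; apply: subvP xA; apply/subv_sumP => F' PF'.
  apply/subvP => _ /memv_imgP[y yd ->]; rewrite -memv_preim dprojE.
  have [<- | FF'] := eqVneq F' F; first by rewrite PF' dinj_in.
  by rewrite dinj_out // mem0v.
rewrite [x]dsum_dinj (bigID (fun F : {set 'I_m} => (F \subset A) && (#|F| == i))) /=.
rewrite [X in _ + X]big1 ?addr0 => [|F /negPf PF]; last first.
  by have := xA F; rewrite PF memv0 => /eqP ->; rewrite linear0.
by apply: memv_sumr => F PF; apply: memv_img; have := xA F; rewrite PF.
Qed.

Lemma sdiffE x : sdiff x =
  \sum_(F : {set 'I_m}) \sum_(e in F)
    sgn F e *: dinj M (F :\ e) (T F (F :\ e) (x F)).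
Proof.
rewrite /sdiff sum_lfunE; apply: eq_bigr => F _; rewrite sum_lfunE.
apply: eq_bigr => e _; apply: etrans (scale_lfunE _ _ _) _; apply: congr1.
apply: etrans (comp_lfunE _ _ _) _; apply: etrans (comp_lfunE _ _ _) _.
by rewrite dprojE.
Qed.

Lemma sdiff_dinj F y : sdiff (dinj M F y) =
  \sum_(e in F) sgn F e *: dinj M (F :\ e) (T F (F :\ e) y).
Proof.
rewrite sdiffE (bigD1 F) //= [X in _ + X]big1 ?addr0 => [|F' F'F].
  by apply: eq_bigr => e _; rewrite dinj_in.
apply: big1 => e _; rewrite [dinj M F y F']dinj_out; last by rewrite eq_sym.
by rewrite !linear0.
Qed.

Lemma sdiff_at x F : sdiff x F =
  \sum_(e | e \notin F) sgn (e |: F) e *: T (e |: F) F (x (e |: F)).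
Proof.
have inT F1 F2 F' y :
    dinj M F2 (T F1 F2 y) F' = if F2 == F' then T F1 F' y else 0.
  by case: eqVneq => [<-|?]; rewrite ?dinj_in ?dinj_out.
rewrite sdiffE dsum_sumE.
under eq_bigr => F' _.
  rewrite dsum_sumE; under eq_bigr => e _ do rewrite dsumZE inT.
  over.
rewrite (exchange_big_dep predT) //= [RHS]big_mkcond; apply: eq_bigr => e _.
have [eF|eF] := boolP (e \in F); rewrite /=.
  apply: big1 => F' eF'; case: eqP => [F'F|_]; last by rewrite scaler0.
  by move: eF; rewrite -F'F !inE eqxx.
rewrite (bigD1 (e |: F)) ?setU11 //= setU1K // eqxx big1 ?addr0 // => F' /andP[eF' F'F].
case: eqP => [E|_]; last by rewrite scaler0.
by move: F'F; rewrite -E setD1K ?eqxx.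
Qed.

Hypothesis T_comp : forall F F' F'' y, F'' \subset F' -> F' \subset F ->
  T F' F'' (T F F' y) = T F F'' y.
Hypothesis T_deg : forall F F' y, y \in dg F -> T F F' y \in dg F'.

(** Of two edges, deleting the later one removes one edge counted after the earlier one, whereas
    deleting the earlier one changes nothing after the later one. *)
Lemma sgn_swap F e f : e \in F -> f \in F -> e != f ->
  sgn F e * sgn (F :\ e) f = - (sgn F f * sgn (F :\ f) e).
Proof.
have main (e' f' : 'I_m) : e' \in F -> f' \in F -> (e' < f')%N ->
    sgn F e' * sgn (F :\ e') f' = - (sgn F f' * sgn (F :\ f') e').
  move=> eF fF ef; rewrite /sgn.
  have -> : [set k in F :\ e' | (f' < k)%N] = [set k in F | (f' < k)%N].
    apply/setP => k; rewrite !inE; case: eqP => //= ->.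
    by rewrite [(_ < e')%N]ltnNge ltnW // andbF.
  have -> : [set k in F | (e' < k)%N] = f' |: [set k in F :\ f' | (e' < k)%N].
    by apply/setP => k; rewrite !inE; case: eqP => //= ->; rewrite fF ef.
  by rewrite cardsU1 !inE eqxx /= add1n exprS mulN1r mulNr mulrC.
move=> eF fF; rewrite neq_ltn => /orP[] lt; first exact: main.
by rewrite [in RHS]main // opprK.
Qed.

Lemma sdiff_sdiff x : sdiff (sdiff x) = 0.
Proof.
rewrite [x]dsum_dinj !linear_sum; apply: big1 => F _ /=; rewrite sdiff_dinj.
rewrite linear_sum; set y := x F.
pose t e f := (sgn F e * sgn (F :\ e) f) *:
  dinj M (F :\ e :\ f) (T F (F :\ e :\ f) y).
have tN e f : e \in F -> f \in F -> e != f -> t e f = - t f e.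
  move=> eF fF ef; rewrite /t sgn_swap // scaleNr.
  suff -> : F :\ e :\ f = F :\ f :\ e by [].
  by rewrite setDDl setUC -setDDl.
set X := \sum_(e in F) _.
have XE : X = \sum_(e in F) \sum_(f in F :\ e) t e f.
  apply: eq_bigr => e eF; rewrite linearZ /= sdiff_dinj scaler_sumr.
  by apply: eq_bigr => f _; rewrite scalerA T_comp ?subsetDl.
(* Both orders of deletion reach the same state and, by [T_comp], through the same map; exchanging
   [e] and [f] only flips the sign. *)
have XN : X = - X.
  rewrite XE -[in RHS]sumrN (exchange_big_dep (fun f => f \in F)) /=; last first.
    by move=> e f _; rewrite inE => /andP[].
  apply: eq_bigr => f fF; rewrite -sumrN; apply: eq_big => [e|e /andP[eF]].
    by rewrite !inE fF andbT eq_sym andbC.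
  by rewrite !inE => /andP[fe _]; apply: tN; rewrite // eq_sym.
have /eqP : X *+ 2 = 0 by rewrite mulr2n {1}XN addNr.
by rewrite -scaler_nat scaler_eq0 pnatr_eq0 => /eqP.
Qed.

Lemma sdiff_schain A i x : x \in schain A i.+1 -> sdiff x \in schain A i.
Proof.
move=> /mem_schain xA; apply/mem_schain => F; rewrite sdiff_at rpred_sum // => e eF.
rewrite rpredZ //; have := xA (e |: F); rewrite cardsU1 eF add1n eqSS.
case: (_ == i); rewrite ?andbT ?andbF; last first.
  by rewrite memv0 => /eqP ->; rewrite linear0 mem0v.
rewrite subUset sub1set; case: (F \subset A); rewrite ?andbT ?andbF.
  case: ifP => _; first exact: T_deg.
  by rewrite memv0 => /eqP ->; rewrite linear0 mem0v.
by rewrite memv0 => /eqP ->; rewrite linear0 mem0v.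
Qed.

Lemma sdiff_schain0 A x : x \in schain A 0 -> sdiff x = 0.
Proof.
move=> /mem_schain xA; apply: dsumP => F; rewrite sdiff_at dsum0E big1 // => e eF.
have := xA (e |: F); rewrite cardsU1 eF add1n andbF memv0 => /eqP ->.
by rewrite linear0 scaler0.
Qed.

Lemma schainS A A' i : A \subset A' -> (schain A i <= schain A' i)%VS.
Proof.
move=> AA'; apply/subvP => x /mem_schain xA; apply/mem_schain => F.
have := xA F; have [FA|] /= := boolP (F \subset A).
  by rewrite (subset_trans FA AA').
by rewrite memv0 => _ /eqP ->; rewrite mem0v.
Qed.

Lemma schainI A A' i x :
  (x \in schain (A :&: A') i) = (x \in schain A i) && (x \in schain A' i).
Proof.
apply/idP/andP => [xA | [/mem_schain xA /mem_schain xA']].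
  by split; apply: subvP xA; apply: schainS; rewrite ?subsetIl ?subsetIr.
apply/mem_schain => F; rewrite subsetI; move: (xA F) (xA' F).
by do 2 case: (F \subset _).
Qed.

Section Triangle.
Variables (e1 e2 e3 : 'I_m).
Hypotheses (e13 : e1 != e3) (e23 : e2 != e3).
Hypothesis T_inv : forall F y, e1 \in F -> e2 \in F -> e3 \in F ->
  T (F :\ e3) F (T F (F :\ e3) y) = y.
Hypothesis T_invr : forall F y, e1 \in F -> e2 \in F -> e3 \in F ->
  T F (F :\ e3) (T (F :\ e3) F y) = y.

(* The states containing e1 and e2 generate the quotient by A + B; T pairs each
   such state without e3 to the one with e3, whence the contraction htpy. *)
Definition avoid12 x := forall F, e1 \in F -> e2 \in F -> x F = 0.

Definition htpy : 'End(dsum M) :=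
  \sum_(F : {set 'I_m} | [&& e1 \in F, e2 \in F & e3 \in F])
    sgn F e3 *: (dinj M F \o T (F :\ e3) F \o dproj M (F :\ e3))%VF.

Definition part_avoid1 : 'End(dsum M) :=
  \sum_(F : {set 'I_m} | e1 \notin F) (dinj M F \o dproj M F)%VF.

Lemma htpy_at x F : htpy x F =
  if [&& e1 \in F, e2 \in F & e3 \in F] then
    sgn F e3 *: T (F :\ e3) F (x (F :\ e3)) else 0.
Proof.
rewrite sum_lfunE dsum_sumE.
have E F' : ((sgn F' e3 *: (dinj M F' \o T (F' :\ e3) F' \o dproj M (F' :\ e3)))%VF x) F
    = if F' == F then sgn F e3 *: T (F :\ e3) F (x (F :\ e3)) else 0.
  rewrite scale_lfunE !comp_lfunE dprojE dsumZE.
  by case: eqVneq => [->|FF]; rewrite ?dinj_in ?dinj_out ?scaler0.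
rewrite (eq_bigr _ (fun F' _ => E F')); case: ifP => PF.
  by rewrite (bigD1 F) //= eqxx big1 ?addr0 // => F' /andP[_ /negPf ->].
by apply: big1 => F' PF'; case: eqP => // FF; rewrite FF PF in PF'.
Qed.

Lemma part_avoid1_at x F : part_avoid1 x F = if e1 \notin F then x F else 0.
Proof.
rewrite sum_lfunE dsum_sumE.
have E F' : ((dinj M F' \o dproj M F')%VF x) F = if F' == F then x F else 0.
  rewrite comp_lfunE dprojE.
  by case: eqVneq => [->|FF]; rewrite ?dinj_in ?dinj_out.
rewrite (eq_bigr _ (fun F' _ => E F')); case: ifP => PF.
  by rewrite (bigD1 F) //= eqxx big1 ?addr0 // => F' /andP[_ /negPf ->].
by apply: big1 => F' PF'; case: eqP => // FF; rewrite FF PF in PF'.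
Qed.

Lemma sgn_neq0 F e : sgn F e != 0.
Proof. by rewrite signr_eq0. Qed.

Lemma sgn2 F e : sgn F e * sgn F e = 1.
Proof. by rewrite -expr2 sqrr_sign. Qed.

(** Adding to [F] an edge other than [e3] gives again a state with [e1] and [e2] and without [e3],
    where [x] vanishes. *)
Lemma sdiff_at3 x F : e1 \in F -> e2 \in F -> e3 \notin F ->
  (forall F', e1 \in F' -> e2 \in F' -> e3 \notin F' -> x F' = 0) ->
  sdiff x F = sgn (e3 |: F) e3 *: T (e3 |: F) F (x (e3 |: F)).
Proof.
move=> F1 F2 F3 x0; rewrite sdiff_at (bigD1 e3) //= big1 ?addr0 // => e /andP[eF ee3].
by rewrite x0 ?linear0 ?scaler0 // !inE ?F1 ?F2 ?orbT // negb_or eq_sym ee3.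
Qed.

(** Consider states containing [e1] and [e2]. At one without [e3], the differential of [htpy x]
    gives back [x] by [T_invr], the sign being squared, so [z] vanishes there. At a state [F] with
    [e3], use [sdiff z = sdiff x], which vanishes at [F :\ e3]: only the term from [z F] survives
    there, and [T_inv] makes it injective in [z F]. *)
Lemma avoid12_contract x : avoid12 (sdiff x) -> avoid12 (x - sdiff (htpy x)).
Proof.
move=> Sx; set z := x - _.
have z0 F : e1 \in F -> e2 \in F -> e3 \notin F -> z F = 0.
  move=> F1 F2 F3; rewrite dsumBE sdiff_at3 // => [|F' _ _ /negPf F'3]; last first.
    by rewrite htpy_at F'3 !andbF.
  rewrite htpy_at !inE F1 F2 eqxx !orbT /= setU1K // [T _ _ (_ *: _)]linearZ /=.
  rewrite scalerA sgn2 scale1r.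
  have := T_invr (F := e3 |: F); rewrite setU1K // => ->;
    rewrite ?inE ?F1 ?F2 ?eqxx ?orbT //.
  by rewrite subrr.
move=> F F1 F2; have [F3|F3] := boolP (e3 \in F); last exact: z0.
have F'1 : e1 \in F :\ e3 by rewrite !inE e13.
have F'2 : e2 \in F :\ e3 by rewrite !inE e23.
have F'3 : e3 \notin F :\ e3 by rewrite !inE eqxx.
have : sdiff z (F :\ e3) = 0.
  by rewrite linearB /= sdiff_sdiff subr0 Sx.
rewrite sdiff_at3 // setD1K // => /eqP; rewrite scaler_eq0 (negPf (sgn_neq0 _ _)) /=.
move=> /eqP Tz; by rewrite -(T_inv (z F) F1 F2 F3) Tz linear0.
Qed.

Lemma subset_setT1 e F : (F \subset [set: 'I_m] :\ e) = (e \notin F).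
Proof. by rewrite subsetD1 subsetT. Qed.

(** A state left after removing the part without [e1] contains [e1]; if it also contains [e2], then
    [x] vanishes there. *)
Lemma avoid12_split i x : x \in schain [set: 'I_m] i -> avoid12 x ->
  part_avoid1 x \in schain ([set: 'I_m] :\ e1) i /\
  x - part_avoid1 x \in schain ([set: 'I_m] :\ e2) i.
Proof.
move=> /mem_schain xE Sx; split; apply/mem_schain => F; have := xE F;
  rewrite subsetT /= subset_setT1 ?dsumBE part_avoid1_at.
  by case: (e1 \notin F); rewrite //= mem0v.
have [F1|F1] := boolP (e1 \in F); rewrite /= ?subrr ?mem0v // subr0.
have [F2|F2] := boolP (e2 \in F); rewrite //=.
by rewrite Sx // memv0.
Qed.

Lemma avoid12_sum i x y : x \in schain ([set: 'I_m] :\ e1) i ->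
  y \in schain ([set: 'I_m] :\ e2) i -> avoid12 (x + y).
Proof.
move=> /mem_schain xA /mem_schain yB F F1 F2; move: (xA F) (yB F).
rewrite !subset_setT1 F1 F2 /= !memv0 dsumDE => /eqP -> /eqP ->.
by rewrite addr0.
Qed.

Lemma htpy_schain i x : x \in schain [set: 'I_m] i ->
  htpy x \in schain [set: 'I_m] i.+1.
Proof.
move=> /mem_schain xE; apply/mem_schain => F; rewrite subsetT htpy_at /=.
case: ifP => [/and3P[_ _ F3]|_]; last exact: mem0v.
rewrite rpredZ //; have := xE (F :\ e3); rewrite subsetT /=.
rewrite (cardsD1 e3 F) F3 add1n eqSS; case: ifP => _; first exact: T_deg.
by rewrite memv0 => /eqP ->; rewrite linear0 mem0v.
Qed.

End Triangle.

Section Action.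
Variable c : forall F, 'End(M F).
Hypothesis cT : forall F F' y, T F F' (c F y) = c F' (T F F' y).
Hypothesis c_deg : forall F y, y \in dg F -> c F y \in dg F.

Definition sact : 'End(dsum M) :=
  \sum_(F : {set 'I_m}) (dinj M F \o c F \o dproj M F)%VF.

Lemma sact_at x F : sact x F = c F (x F).
Proof.
rewrite sum_lfunE dsum_sumE (bigD1 F) //= big1 => [|F' F'F].
  by rewrite addr0 !comp_lfunE dinj_in dprojE.
by rewrite !comp_lfunE dinj_out.
Qed.

Lemma sdiff_sact x : sdiff (sact x) = sact (sdiff x).
Proof.
apply: dsumP => F; rewrite sact_at !sdiff_at linear_sum; apply: eq_bigr => e _.
by rewrite linearZ /= -cT sact_at.
Qed.

Lemma sact_schain A i x : x \in schain A i -> sact x \in schain A i.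
Proof.
move=> /mem_schain xA; apply/mem_schain => F; have := xA F; rewrite sact_at.
case: ifP => _; first exact: c_deg.
by rewrite !memv0 => /eqP ->; rewrite linear0.
Qed.

End Action.
End StateComplex.

(** * Maps of pairs and exactness of direct sums *)

Section LinearMaps.
Variables (K : fieldType) (U V W : vectType K).

Definition pair_fun (f : 'Hom(U, V)) (g : 'Hom(U, W)) u : (V * W)%type := (f u, g u).
Fact pair_fun_linear f g : linear (pair_fun f g).
Proof. by move=> a u v; rewrite /pair_fun !linearP. Qed.
HB.instance Definition _ f g :=
  GRing.isLinear.Build K _ _ _ (pair_fun f g) (pair_fun_linear f g).
Definition pair_lfun f g : 'Hom(U, (V * W)%type) := linfun (pair_fun f g).

Lemma pair_lfunE f g u : pair_lfun f g u = (f u, g u).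
Proof. by rewrite lfunE. Qed.

Definition copair_fun (f : 'Hom(V, U)) (g : 'Hom(W, U)) (x : V * W) := f x.1 + g x.2.
Fact copair_fun_linear f g : linear (copair_fun f g).
Proof.
by move=> a x y; rewrite /copair_fun !linearP scalerDr addrACA.
Qed.
HB.instance Definition _ f g :=
  GRing.isLinear.Build K _ _ _ (copair_fun f g) (copair_fun_linear f g).
Definition copair_lfun f g : 'Hom((V * W)%type, U) := linfun (copair_fun f g).

Lemma copair_lfunE f g x : copair_lfun f g x = f x.1 + g x.2.
Proof. by rewrite lfunE. Qed.
End LinearMaps.

Section DirectSumMap.
Variables (K : fieldType) (J : finType) (T U : J -> vectType K).
Variable f : forall j, 'Hom(T j, U j).

Definition dmap_fun (x : dsum T) : dsum U := [ffun j => f j (x j)].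
Fact dmap_fun_linear : linear dmap_fun.
Proof. by move=> a x y; apply: dsumP => j; rewrite !ffunE linearP. Qed.
HB.instance Definition _ :=
  GRing.isLinear.Build K _ _ _ dmap_fun dmap_fun_linear.
Definition dmap : 'Hom(dsum T, dsum U) := linfun dmap_fun.

Lemma dmapE x j : dmap x j = f j (x j).
Proof. by rewrite lfunE /= ffunE. Qed.
End DirectSumMap.

(** Finite choice over the summands: exactness in each degree yields preimages only as existence
    statements. *)
Lemma dsum_exists (K : fieldType) (J : finType) (T : J -> vectType K)
    (P : forall j, T j -> Prop) :
  (forall j, exists y, P j y) -> exists y : dsum T, forall j, P j (y j).
Proof.
move=> /fin_all_exists[y yP]; exists (finfun y : dsum T) => j.
by rewrite ffunE.
Qed.

Section DirectSumExact.
Variables (K : fieldType) (J : finType) (D A B E D' : J -> vectType K).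
Variables (iA : forall j, 'Hom(D j, A j)) (iB : forall j, 'Hom(D j, B j)).
Variables (jA : forall j, 'Hom(A j, E j)) (jB : forall j, 'Hom(B j, E j)).
Variable (del : forall j, 'Hom(E j, D' j)).

Definition dphi := pair_lfun (dmap iA) (- dmap iB)%VF.
Definition dpsi := copair_lfun (dmap jA) (dmap jB).
Definition ddel := dmap del.

Lemma dphiE y : dphi y = (dmap iA y, - dmap iB y).
Proof. by rewrite /dphi pair_lfunE opp_lfunE. Qed.

Lemma dphi1_at y j : (dphi y).1 j = iA j (y j).
Proof. by rewrite dphiE dmapE. Qed.

Lemma dphi2_at y j : (dphi y).2 j = - iB j (y j).
Proof. by rewrite dphiE ffunE dmapE. Qed.

Lemma dpsi_at a b j : dpsi (a, b) j = jA j (a j) + jB j (b j).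
Proof. by rewrite /dpsi copair_lfunE dsumDE !dmapE. Qed.

Lemma ddel_at y j : ddel y j = del j (y j).
Proof. exact: dmapE. Qed.

Lemma dsum_exact_middle :
  (forall j a b, jA j a + jB j b = 0 <-> exists y, a = iA j y /\ b = - iB j y) ->
  exact_at dphi dpsi.
Proof.
move=> ex; apply/vspaceP => -[a b]; rewrite memv_ker.
apply/memv_imgP/eqP => [[y _ ] | ab0].
  rewrite dphiE => -[-> ->]; apply: dsumP => j.
  rewrite dpsi_at dsum0E; apply/ex; exists (y j).
  by rewrite !ffunE !dmapE.
have [j|y yP] := dsum_exists (P := fun j y => a j = iA j y /\ b j = - iB j y).
  by apply/ex; rewrite -dpsi_at ab0 dsum0E.
exists y; rewrite ?memvf // dphiE; congr (_, _); apply: dsumP => j.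
  by rewrite dmapE; case: (yP j).
by rewrite ffunE dmapE; case: (yP j).
Qed.

Lemma dsum_exact_E :
  (forall j y, del j y = 0 <-> exists a b, y = jA j a + jB j b) ->
  exact_at dpsi ddel.
Proof.
move=> ex; apply/vspaceP => y; rewrite memv_ker.
apply/memv_imgP/eqP => [[[a b] _ ->] | y0].
  apply: dsumP => j; rewrite dmapE dsum0E; apply/ex; exists (a j), (b j).
  exact: dpsi_at.
have [j|a aP] := dsum_exists (P := fun j a => exists b, y j = jA j a + jB j b).
  by apply/ex; rewrite -dmapE -/ddel y0 dsum0E.
have [//|b bP] := dsum_exists (P := fun j b => y j = jA j (a j) + jB j b).
by exists (a, b); rewrite ?memvf //; apply: dsumP => j; rewrite dpsi_at.
Qed.

Lemma dsum_surj :
  (forall j y, exists a b, y = jA j a + jB j b) -> limg dpsi = fullv.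
Proof.
move=> ex; apply/vspaceP => y; rewrite memvf; apply/memv_imgP.
have [j|a aP] := dsum_exists (P := fun j a => exists b, y j = jA j a + jB j b).
  exact: ex.
have [//|b bP] := dsum_exists (P := fun j b => y j = jA j (a j) + jB j b).
by exists (a, b); rewrite ?memvf //; apply: dsumP => j; rewrite dpsi_at.
Qed.

End DirectSumExact.

(** Here [del] ends in the source of [dphi]. The preceding section keeps its target [D'] as a
    separate family, since in the application it sits one homological degree lower. *)
Lemma dsum_exact_D (K : fieldType) (J : finType) (D A B E : J -> vectType K)
    (iA : forall j, 'Hom(D j, A j)) (iB : forall j, 'Hom(D j, B j))
    (del : forall j, 'Hom(E j, D j)) :
  (forall j y, (iA j y = 0 /\ iB j y = 0) <-> exists w, y = del j w) ->
  exact_at (ddel del) (dphi iA iB).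
Proof.
move=> ex; apply/vspaceP => y; rewrite memv_ker dphiE.
apply/memv_imgP/eqP => [[w _ ->] | /pair_equal_spec[y1 y2]].
  have yj j : iA j (dmap del w j) = 0 /\ iB j (dmap del w j) = 0.
    by apply/ex; exists (w j); rewrite dmapE.
  by congr (_, _); apply: dsumP => j; rewrite ?ffunE dmapE;
    case: (yj j) => // e1 e2; rewrite /ddel ?e1 ?e2 ?oppr0.
have [j|w wP] := dsum_exists (P := fun j w => y j = del j w).
  apply/ex; split; first by rewrite -dmapE y1 dsum0E.
  by apply/eqP; rewrite -dmapE -oppr_eq0 -[0](dsum0E B j) -y2 ffunE.
by exists w; rewrite ?memvf //; apply: dsumP => j; rewrite dmapE.
Qed.

(** * Triangles *)

Section TriangleStates.
Variables (n m : nat) (G : multigraph n m) (e1 e2 e3 : 'I_m).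
Hypothesis tri : triangle G e1 e2 e3.

(** An edge determines its unordered pair of ends, and the three edges join three different pairs of
    vertices. *)
Lemma triangle_neq : [/\ e1 != e2, e1 != e3 & e2 != e3].
Proof.
have [u [v [w [[uv vw uw] [j1 j2 j3]]]]] := tri.
have J e a b c d : joins G e a b -> joins G e c d ->
    (a == c) && (b == d) || (a == d) && (b == c).
  rewrite /joins => /orP[] /eqP -> /orP[] /eqP[-> ->]; rewrite !eqxx ?orbT //.
split; apply/eqP => E.
- move: j1; rewrite E => /J/(_ j2).
  by rewrite (negPf uv) (negPf uw).
- move: j1; rewrite E => /J/(_ j3).
  by rewrite (negPf vw) (negPf uw) andbF.
- move: j2; rewrite E => /J/(_ j3).
  by rewrite eq_sym (negPf uv) (negPf vw).
Qed.

(** A step along [e3] is replaced by the path along [e1] and [e2] through the third vertex; both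
    edges survive the deletion. *)
Lemma triangle_refines (F : {set 'I_m}) : e1 \in F -> e2 \in F ->
  refines G F (F :\ e3).
Proof.
have [e12 e13 e23] := triangle_neq.
move=> F1 F2; apply: connect_sub => a b /existsP[e /andP[eF eab]].
have [ee3|ee3] := eqVneq e e3; last first.
  by apply: connect1; apply/existsP; exists e; rewrite !inE ee3 eF.
have [u [v [w [_ [j1 j2 j3]]]]] := tri.
have uw : connect (adj G (F :\ e3)) u w.
  apply: (connect_trans (y := v)); apply: connect1; apply/existsP.
    by exists e1; rewrite !inE e13 F1.
  by exists e2; rewrite !inE e23 F2.
move: eab j3; rewrite ee3 /joins => /orP[] /eqP -> /orP[] /eqP[-> ->] //;
  by rewrite conn_sym.
Qed.

End TriangleStates.

(** * The sequence for chromatic symmetric homology *)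

Section ChromaticMV.
Variables (C : numClosedFieldType) (n m : nat) (G : multigraph n m).
Variables (e1 e2 e3 : 'I_m).
Hypothesis tri : triangle G e1 e2 e3.
Local Notation Mmod := (Mmod C G).
Local Notation Mdeg := (Mdeg C G).
Local Notation T := (transfer C G).
Local Notation d := (diff C G).
Local Notation act s := (fun F => indact (youngS G F) (extact C G F) s).

Implicit Types (F X : {set 'I_m}) (i : nat) (g : 'S_n).

Lemma diffE : d = sdiff T.
Proof.
apply: eq_bigr => F _; apply: eq_bigr => e _; apply: congr1.
by apply: (congr1 (fun f => (_ \o f \o _)%VF)); apply: dedgeE.
Qed.

Lemma transfer_comp_sub F F' F'' (y : Mmod F) : F'' \subset F' -> F' \subset F ->
  T F' F'' (T F F' y) = T F F'' y.
Proof. by move=> s'' s'; apply: transfer_comp; apply: refines_subset. Qed.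

(** Mutual refinement lets [transfer_comp] collapse the round trip to a transfer from a state to
    itself. *)
Lemma transfer_inv F (y : Mmod F) : e1 \in F -> e2 \in F -> e3 \in F ->
  T (F :\ e3) F (T F (F :\ e3) y) = y.
Proof.
move=> F1 F2 _; apply: etrans (transfer_comp _ _ y) (transfer_id y).
  exact: (triangle_refines tri F1 F2).
by apply: refines_subset; apply: subsetDl.
Qed.

Lemma transfer_invr F (y : Mmod (F :\ e3)) : e1 \in F -> e2 \in F -> e3 \in F ->
  T F (F :\ e3) (T (F :\ e3) F y) = y.
Proof.
move=> F1 F2 _; apply: etrans (transfer_comp _ _ y) (transfer_id y).
  by apply: refines_subset; apply: subsetDl.
exact: (triangle_refines tri F1 F2).
Qed.

Lemma diff_diff x : d (d x) = 0.
Proof. by rewrite diffE; apply: sdiff_sdiff; apply: transfer_comp_sub. Qed.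

Lemma diff_Cmod X (j : 'I_n.+1) i x :
  x \in Cmod C G X i.+1 j -> d x \in Cmod C G X i j.
Proof. by rewrite diffE; apply: sdiff_schain => F F' y; apply: transfer_deg. Qed.

Lemma diff_Cmod0 X (j : 'I_n.+1) x : x \in Cmod C G X 0 j -> d x = 0.
Proof. by rewrite diffE; apply: sdiff_schain0. Qed.

Lemma Cmod_sub X X' (j : nat) i : X \subset X' ->
  (Cmod C G X i j <= Cmod C G X' i j)%VS.
Proof. exact: schainS. Qed.

Local Notation E := [set: 'I_m].
Local Notation A := (E :\ e1).
Local Notation B := (E :\ e2).
Local Notation AB := (E :\ e1 :\ e2).

Lemma Cmod_AB (j : nat) i x :
  (x \in Cmod C G AB i j) = (x \in Cmod C G A i j) && (x \in Cmod C G B i j).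
Proof.
apply: etrans (schainI _ _ _ _ _); congr (x \in Cmod C G _ i j).
by rewrite setDDl setDUr.
Qed.

Let S := @avoid12 C m Mmod e1 e2.
Let s := htpy T e1 e2 e3.
Let p := part_avoid1 Mmod e1.

Lemma contractC x : S (d x) -> S (x - d (s x)).
Proof.
have [_ e13 e23] := triangle_neq tri.
rewrite diffE; apply: avoid12_contract => // *.
- exact: transfer_comp_sub.
- exact: transfer_inv.
- exact: transfer_invr.
Qed.

Lemma s_Cmod (j : 'I_n.+1) i x : x \in Cmod C G E i j -> s x \in Cmod C G E i.+1 j.
Proof. by apply: htpy_schain => F F' y; apply: transfer_deg. Qed.

Lemma act_Cmod g X (j : nat) i x :
  x \in Cmod C G X i j -> chact C G g x \in Cmod C G X i j.
Proof. by apply: (sact_schain (c := act g)) => F y; apply: indact_deg. Qed.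

Lemma diff_chact g x : d (chact C G g x) = chact C G g (d x).
Proof.
by rewrite diffE; apply: (sdiff_sact (c := act g)) => F F' y; apply: transfer_indact.
Qed.

Let XE (j : 'I_n.+1) i := Cmod C G E i j.
Let XA (j : 'I_n.+1) i := Cmod C G A i j.
Let XB (j : 'I_n.+1) i := Cmod C G B i j.
Let XD (j : 'I_n.+1) i := Cmod C G AB i j.

Let AE j i : (XA j i <= XE j i)%VS.
Proof. by apply: Cmod_sub; apply: subsetT. Qed.
Let BE j i : (XB j i <= XE j i)%VS.
Proof. by apply: Cmod_sub; apply: subsetT. Qed.
Let DA j i : (XD j i <= XA j i)%VS.
Proof. by apply: Cmod_sub; apply: subsetDl. Qed.
Let DB j i : (XD j i <= XB j i)%VS.
Proof. by apply: Cmod_sub; apply: setSD; apply: subsetT. Qed.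

Let dE j i x : x \in XE j i.+1 -> d x \in XE j i.
Proof. exact: diff_Cmod. Qed.
Let dA j i x : x \in XA j i.+1 -> d x \in XA j i.
Proof. exact: diff_Cmod. Qed.
Let dB j i x : x \in XB j i.+1 -> d x \in XB j i.
Proof. exact: diff_Cmod. Qed.
Let memD j i x : (x \in XD j i) = (x \in XA j i) && (x \in XB j i).
Proof. exact: Cmod_AB. Qed.
Let S_AB j i x y : x \in XA j i -> y \in XB j i -> S (x + y).
Proof. exact: avoid12_sum. Qed.
Let S_split j i x : x \in XE j i -> S x -> p x \in XA j i /\ x - p x \in XB j i.
Proof. exact: avoid12_split. Qed.
Let sE j i x : x \in XE j i -> s x \in XE j i.+1.
Proof. exact: s_Cmod. Qed.

(** One triad for each exterior degree, all with the same [S], [s] and [p]. *)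
Let triadC j : triad d (XE j) (XA j) (XB j) (XD j) S s p.
Proof.
split; [exact: diff_diff|exact: dE|exact: dA|exact: dB|move=> x; exact: diff_Cmod0|
  exact: memD|exact: AE|exact: BE|exact: S_AB|exact: S_split|exact: sE|
  exact: contractC].
Qed.

Definition H_incl_DA i j := incl d (XD j) (XA j) i.
Definition H_incl_DB i j := incl d (XD j) (XB j) i.
Definition H_incl_AE i j := incl d (XA j) (XE j) i.
Definition H_incl_BE i j := incl d (XB j) (XE j) i.
Definition H_connecting i j := connecting d (XE j) (XD j) s p i.

Lemma Hclass_at X i (x : 'I_n.+1 -> chain C G) (j : 'I_n.+1) :
  Hclass X i x j = cl d (fun k => Cmod C G X k j) i (x j).
Proof. by rewrite ffunE. Qed.

Lemma Hact_at X i g (y : homology C G X i) (j : 'I_n.+1) :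
  Hact g y j = hact (chact C G g) (y j : Hmod d (fun k => Cmod C G X k j) i).
Proof. by rewrite Hclass_at /hact /rep sqreprE. Qed.

(** Reduces equivariance to one exterior degree. [f] is a bare function with its own target degree,
    which covers the inclusions, the negated inclusion in [phi] and the connecting map. *)
Lemma Hact_natural X X' i i' g (j : 'I_n.+1)
    (f : Hmod d (fun k => Cmod C G X k j) i ->
         Hmod d (fun k => Cmod C G X' k j) i')
    (y : homology C G X i) (y' : homology C G X' i') :
  (forall z, f (hact (chact C G g) z) = hact (chact C G g) (f z)) ->
  y' j = f (y j) -> f (Hact g y j) = Hact g y' j.
Proof. by move=> fg y'j; rewrite !Hact_at y'j fg. Qed.

Lemma incl_act X X' i g (j : 'I_n.+1)
    (z : Hmod d (fun k => Cmod C G X k j) i) : X \subset X' ->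
  incl d (fun k => Cmod C G X k j) (fun k => Cmod C G X' k j) i
    (hact (chact C G g) z) =
  hact (chact C G g) (incl d _ (fun k => Cmod C G X' k j) i z).
Proof.
move=> XX'; apply: incl_hact => *.
- exact: diff_chact.
- exact: act_Cmod.
- exact: act_Cmod.
- exact: Cmod_sub.
Qed.

Lemma connecting_act i g j (z : Hmod d (XE j) i.+1) :
  H_connecting i j (hact (chact C G g) z) =
  hact (chact C G g) (H_connecting i j z).
Proof.
pose cX X k x := @act_Cmod g X j k x.
exact: (connecting_hact (triadC j) (diff_chact g) (cX A) (cX B) (cX E) z).
Qed.

Lemma chromatic_mayer_vietoris :
  let H X i := homology C G X i in
  exists (phi : forall i : nat, 'Hom(H AB i, (H A i * H B i)%type))
         (psi : forall i : nat, 'Hom((H A i * H B i)%type, H E i))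
         (delta : forall i : nat, 'Hom(H E i.+1, H AB i)),
  [/\ (forall (i : nat) (x : 'I_n.+1 -> chain C G),
         (forall j : 'I_n.+1, x j \in cycles C G AB i j) ->
         phi i (Hclass AB i x) = (Hclass A i x, Hclass B i (fun j => - x j))),
      (forall (i : nat) (a b : 'I_n.+1 -> chain C G),
         (forall j : 'I_n.+1, a j \in cycles C G A i j) ->
         (forall j : 'I_n.+1, b j \in cycles C G B i j) ->
         psi i (Hclass A i a, Hclass B i b) = Hclass E i (fun j => a j + b j)),
      (forall (i : nat) (s : 'S_n),
         [/\ forall y, phi i (Hact s y) = (Hact s (phi i y).1, Hact s (phi i y).2),
             forall y z, psi i (Hact s y, Hact s z) = Hact s (psi i (y, z))
           & forall y, delta i (Hact s y) = Hact s (delta i y)]),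
      (forall (i : nat) (j : 'I_n.+1) (y : H E i.+1),
         homogeneous j y -> homogeneous j (delta i y))
    & [/\ forall i : nat, exact_at (phi i) (psi i),
          forall i : nat, exact_at (psi i.+1) (delta i),
          forall i : nat, exact_at (delta i) (phi i)
        & limg (psi 0%N) = fullv]].
Proof.
move=> H.
exists (fun i => dphi (H_incl_DA i) (H_incl_DB i)).
exists (fun i => dpsi (H_incl_AE i) (H_incl_BE i)).
exists (fun i => ddel (H_connecting i)).
split.
- move=> i x xZ; rewrite dphiE; congr (_, _); apply: dsumP => j.
    by rewrite dmapE !Hclass_at; apply: (incl_cl (X := XD j) (DA j) (xZ j)).
  rewrite ffunE dmapE !Hclass_at linearN; apply: (congr1 -%R).
  exact: (incl_cl (X := XD j) (DB j) (xZ j)).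
- move=> i a b aZ bZ; apply: dsumP => j; rewrite dpsi_at !Hclass_at linearD.
  apply: (congr2 +%R); first exact: (incl_cl (X := XA j) (AE j) (aZ j)).
  exact: (incl_cl (X := XB j) (BE j) (bZ j)).
- move=> i g; split=> [y | y z | y].
  + rewrite [LHS]surjective_pairing; congr (_, _); apply: dsumP => j.
      apply: etrans (dphi1_at _ _ _ _) _.
      apply: (Hact_natural (f := H_incl_DA i j)) (dphi1_at _ _ _ _) => z.
      by apply: incl_act; apply: subsetDl.
    apply: etrans (dphi2_at _ _ _ _) _.
    apply: (Hact_natural (f := fun z => - H_incl_DB i j z)) (dphi2_at _ _ _ _) => z.
    apply: etrans _ (esym (hactN _ _)); apply: (congr1 -%R).
    by apply: incl_act; apply: setSD; apply: subsetT.
  + apply: dsumP => j; apply: etrans (dpsi_at _ _ _ _ _) _.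
    have e := dpsi_at (H_incl_AE i) (H_incl_BE i) y z j.
    rewrite [RHS]Hact_at e.
    have -> := hactD (chact C G g) (H_incl_AE i j (y j)) (H_incl_BE i j (z j)).
    apply: (congr2 +%R).
      apply: etrans (congr1 (fun_of_lfun (H_incl_AE i j)) (Hact_at _ _ _)) _.
      by apply: incl_act; apply: subsetT.
    apply: etrans (congr1 (fun_of_lfun (H_incl_BE i j)) (Hact_at _ _ _)) _.
    by apply: incl_act; apply: subsetT.
  + apply: dsumP => j; apply: etrans (ddel_at _ _ _) _.
    apply: (Hact_natural (f := H_connecting i j)) (ddel_at _ _ _) => z.
    exact: connecting_act.
(* The connecting map acts separately on each exterior degree, so it preserves homogeneity. *)
- move=> i j y yj k kj; rewrite dmapE yj //; exact: linear0.
split=> [i|i|i|].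
- by apply: dsum_exact_middle => j a b; apply: (MV_exact_middle (triadC j)).
- by apply: dsum_exact_E => j y; apply: (MV_exact_E (triadC j)).
- by apply: dsum_exact_D => j y; apply: (MV_exact_D (triadC j)).
- by apply: dsum_surj => j y; apply: (MV_surj0 (triadC j)).
Qed.

End ChromaticMV.

Local Open Scope complex_scope.

Theorem theorem4p4 (R : realType) (n m : nat) (G : multigraph n m)
    (e1 e2 e3 : 'I_m) (tri : triangle G e1 e2 e3) :
  let E := [set: 'I_m] in
  let A := E :\ e1 in
  let B := E :\ e2 in
  let AB := E :\ e1 :\ e2 in
  let H (X : {set 'I_m}) (i : nat) := homology R[i] G X i in
  exists (phi : forall i : nat, 'Hom(H AB i, (H A i * H B i)%type))
         (psi : forall i : nat, 'Hom((H A i * H B i)%type, H E i))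
         (delta : forall i : nat, 'Hom(H E i.+1, H AB i)),
  [/\ (forall (i : nat) (x : 'I_n.+1 -> chain R[i] G),
         (forall j : 'I_n.+1, x j \in cycles R[i] G AB i j) ->
         phi i (Hclass AB i x) = (Hclass A i x, Hclass B i (fun j => - x j))),
      (forall (i : nat) (a b : 'I_n.+1 -> chain R[i] G),
         (forall j : 'I_n.+1, a j \in cycles R[i] G A i j) ->
         (forall j : 'I_n.+1, b j \in cycles R[i] G B i j) ->
         psi i (Hclass A i a, Hclass B i b) = Hclass E i (fun j => a j + b j)),
      (forall (i : nat) (s : 'S_n),
         [/\ forall y, phi i (Hact s y) = (Hact s (phi i y).1, Hact s (phi i y).2),
             forall y z, psi i (Hact s y, Hact s z) = Hact s (psi i (y, z))
           & forall y, delta i (Hact s y) = Hact s (delta i y)]),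
      (forall (i : nat) (j : 'I_n.+1) (y : H E i.+1),
         homogeneous j y -> homogeneous j (delta i y))
    & [/\ forall i : nat, exact_at (phi i) (psi i),
          forall i : nat, exact_at (psi i.+1) (delta i),
          forall i : nat, exact_at (delta i) (phi i)
        & limg (psi 0%N) = fullv]].
Proof. exact: (chromatic_mayer_vietoris R[i] tri). Qed.
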